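(* Let $[\mathfrak A,n,r,\beta]$ be a tame pure stratum in $A=\mathrm{End}_F(V)$ such that $r=-k_0(\beta,\mathfrak A)$. For every element $\gamma$ of the field $F[\beta]$ such that $[\mathfrak A,n,r,\gamma]$ is a simple stratum equivalent to $[\mathfrak A,n,r,\beta]$, the stratum $[\mathfrak B_\gamma,r,r-1,\beta-\gamma]$ in the $F[\gamma]$-algebra $\mathrm{End}_{F[\gamma]}(V)$ is simple, where $\mathfrak B_\gamma=\mathfrak A\cap\mathrm{End}_{F[\gamma]}(V)$.
   Context: $F$ is a non-Archimedean local field with ring of integers $\mathfrak o_F$; $V$ is a finite-dimensional $F$-vector space and $A=\mathrm{End}_F(V)$. A hereditary $\mathfrak o_F$-order in $A$ is $\mathfrak A=\{x\in A: xL_i\subset L_i\ \forall i\}$ for an $\mathfrak o_F$-lattice chain $\{L_i\}_{i\in\mathbb Z}$ in $V$; $\mathfrak P$ is its Jacobson radical, $\nu_{\mathfrak A}(x)=\max\{k\in\mathbb Z: x\in\mathfrak P^k\}$, and $\mathfrak K(\mathfrak A)$ is its normaliser in $A^\times$. A stratum in $A$ is a quadruple $[\mathfrak A,n,r,\beta]$ with $\mathfrak A$ a hereditary $\mathfrak o_F$-order, $n>r$ integers, $\beta\in A$ and $\nu_{\mathfrak A}(\beta)\ge -n$. It is pure if $E=F[\beta]$ is a field, $E^\times\subset\mathfrak K(\mathfrak A)$ and $\nu_{\mathfrak A}(\beta)=-n$. For a pure stratum put $\mathfrak N_k(\beta,\mathfrak A)=\{x\in\mathfrak A:\beta x-x\beta\in\mathfrak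 P^k\}$, $\mathfrak B=\mathfrak A\cap\mathrm{End}_E(V)$, and $k_0(\beta,\mathfrak A)=-\infty$ if $E=F$, $k_0(\beta,\mathfrak A)=\max\{k\in\mathbb Z:\mathfrak N_k(\beta,\mathfrak A)\not\subset\mathfrak B+\mathfrak P\}$ if $E\ne F$. A stratum is simple if it is pure and $r<-k_0(\beta,\mathfrak A)$. It is tame pure (resp. tame simple) if it is pure (resp. simple) and $F[\beta]/F$ is tamely ramified. Two strata $[\mathfrak A,n,r,\beta_1]$, $[\mathfrak A,n,r,\beta_2]$ are equivalent if $\beta_1-\beta_2\in\mathfrak P^{-r}$. For a finite extension $K/F$ inside $A$ the same notions are used in $\mathrm{End}_K(V)$ with $F$ replaced by $K$. *)

(* Defs.v *)
(* Mathematical Components, with the classical sets and extended numbers of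
   MathComp-Analysis. *)
From HB Require Import structures.
From mathcomp Require Import all_boot all_order all_algebra.
From mathcomp Require Import boolp classical_sets constructive_ereal.

Set Implicit Arguments.
Unset Strict Implicit.
Unset Printing Implicit Defensive.

Import Order.TTheory GRing.Theory Num.Theory.

Local Open Scope classical_set_scope.
Local Open Scope ring_scope.

(* A non-Archimedean local field: [vF] is the normalised discrete valuation,
   for which the field is complete and has finite residue field. *)
HB.mixin Record Field_isNALocal (F : Type) of GRing.Field F := {
  vF : F -> \bar int;
  vF_eqy : forall x : F, vF x = +oo%E <-> x = 0;
  vFM : forall x y : F, vF (x * y) = (vF x + vF y)%E;
  vFD : forall x y : F, (Order.min (vF x) (vF y) <= vF (x + y)%R)%E;
  vF_uniformizer : exists x : F, vF x = 1%:E;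
  vF_complete : forall u : nat -> F,
    (forall k : int, exists N : nat, forall m n : nat,
       (N <= m)%N -> (N <= n)%N -> (k%:E <= vF (u m - u n)%R)%E) ->
    exists l : F, forall k : int, exists N : nat, forall n : nat,
      (N <= n)%N -> (k%:E <= vF (u n - l)%R)%E;
  vF_finite_residue : exists s : seq F, forall x : F, (0 <= vF x)%E ->
    exists2 y, y \in s & (0 < vF (x - y)%R)%E
}.

#[short(type="naLocalFieldType")]
HB.structure Definition NALocalField := {F of Field_isNALocal F & GRing.Field F}.

(* Maximum of a set of integers; by convention it is -oo for the empty set and
   +oo for a nonempty set without a maximum. *)
Definition is_maxz (S : set int) (m : int) : Prop :=
  S m /\ forall k, S k -> k <= m.

Definition maxz (S : set int) : \bar int :=
  if `[< S = set0 >] then -oo%E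
  else if `[< exists m, is_maxz S m >] then (xget 0 (is_maxz S))%:E
  else +oo%E.

(* Finite sums of elements of S. *)
Definition finsums (U : zmodType) (S : set U) : set U :=
  [set x | exists2 s : seq U, {in s, forall y, S y} & x = \sum_(y <- s) y].

Section Strata.
Variables (F : naLocalFieldType) (V : vectType F).

(* 'End(V) has no canonical ring structure (V may be 0), so the product of A is
   written as the composition \o%VF, with unit \1%VF. *)
Local Notation A := 'End(V).

Implicit Types (K E AA I J : set A) (L : set V) (x y b : A).

Definition lfunX x (i : nat) : A := iter i (fun y => (x \o y)%VF) \1%VF.

(* F as a subfield of A. All notions below are relative to a subfield K of A
   containing F; the notions over F are those for K = scalars. *)
Definition scalars : set A := [set x | exists a : F, x = a *: \1%VF].

Definition adjoin K b : set A :=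
  [set x | exists (m : nat) (c : nat -> A), (forall i, K (c i)) /\
     x = \sum_(i < m) (c i \o lfunX b i)%VF].

Definition is_field E : Prop :=
  [/\ E \1%VF /\ (\1%VF : A) != 0,
      forall x y, E x -> E y -> E (x - y),
      forall x y, E x -> E y -> E (x \o y)%VF,
      forall x y, E x -> E y -> (x \o y)%VF = (y \o x)%VF
    & forall x, E x -> x != 0 -> exists2 y, E y & (x \o y)%VF = \1%VF].

Definition EndK K : set A :=
  [set x | forall c, K c -> forall v : V, x (c v) = c (x v)].

(* The ring of integers of K, as the integral closure of o_F in K; for
   K = scalars it is o_F, since valuation rings are integrally closed. *)
Definition integral x : Prop :=
  exists (m : nat) (a : nat -> F), (forall i, (0 <= vF (a i))%E) /\
    lfunX x m + \sum_(i < m) a i *: lfunX x i = 0.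

Definition integers K : set A := [set x | K x /\ integral x].

Definition max_ideal K : set A :=
  [set x | integers K x /\ ~ exists2 y, integers K y & (x \o y)%VF = \1%VF].

Definition ideal_mul I J : set A :=
  finsums [set (x \o y)%VF | x in I & y in J].

Definition ideal_exp R I (e : nat) : set A := iter e (ideal_mul I) R.

(* For finite extensions E/K of non-Archimedean local fields the residue field
   extension is separable, so tameness only bears on the ramification index. *)
Definition ramification_index K E (e : nat) : Prop :=
  ideal_mul (max_ideal K) (integers E) = ideal_exp (integers E) (max_ideal E) e.

Definition residue_char (p : nat) : Prop := prime p /\ (0 < vF (p%:R : F))%E.

Definition tamely_ramified K E : Prop :=
  exists2 e, ramification_index K E e & forall p, residue_char p -> ~~ (p %| e)%N.

Definition lin_span I (s : seq V) : set V :=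
  [set w | exists c : nat -> A, (forall i, I (c i)) /\
     w = \sum_(i < size s) c i s`_i].

Definition is_lattice K L : Prop :=
  exists2 s : seq V, L = lin_span (integers K) s & lin_span K s = setT.

Definition act_mul I L : set V := finsums [set x v | x in I & v in L].

Definition lattice_chain K (L : int -> set V) : Prop :=
  [/\ forall i, is_lattice K (L i),
      forall i, L (i + 1) `<` L i
    & exists2 e : nat, (0 < e)%N &
        forall i, L (i + e%:Z) = act_mul (max_ideal K) (L i)].

Definition hereditary_order K AA : Prop :=
  exists2 L : int -> set V, lattice_chain K L &
    AA = [set x | EndK K x /\ forall i v, L i v -> L i (x v)].

Definition left_ideal AA I : Prop :=
  [/\ I `<=` AA, I 0, forall x y, I x -> I y -> I (x + y)
    & forall a x, AA a -> I x -> I (a \o x)%VF].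

Definition maximal_left_ideal AA I : Prop :=
  [/\ left_ideal AA I, I <> AA
    & forall J, left_ideal AA J -> I `<=` J -> J = I \/ J = AA].

Definition jacobson AA : set A :=
  [set x | AA x /\ forall I, maximal_left_ideal AA I -> I x].

(* P^k for k in Z, P the radical of AA: for k < 0 this is the inverse of the
   fractional ideal P^(-k) in End_K(V). *)
Definition radX K AA (k : int) : set A :=
  match k with
  | Posz m => ideal_exp AA (jacobson AA) m
  | Negz m => [set x | EndK K x /\
      forall y, ideal_exp AA (jacobson AA) m.+1 y ->
        AA (x \o y)%VF /\ AA (y \o x)%VF]
  end.

Definition nu K AA x : \bar int := maxz [set k | radX K AA k x].

Definition normaliser K AA : set A :=
  [set x | EndK K x /\ exists y,
     [/\ EndK K y, (x \o y)%VF = \1%VF, (y \o x)%VF = \1%VF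
       & [set (x \o a \o y)%VF | a in AA] = AA]].

Definition stratum K AA (n r : int) b : Prop :=
  [/\ hereditary_order K AA, r < n, EndK K b & ((- n)%:E <= nu K AA b)%E].

Definition pure_stratum K AA (n r : int) b : Prop :=
  [/\ stratum K AA n r b, is_field (adjoin K b),
      forall x, adjoin K b x -> x != 0 -> normaliser K AA x
    & nu K AA b = (- n)%:E].

Definition NN K AA b (k : int) : set A :=
  [set x | AA x /\ radX K AA k ((b \o x)%VF - (x \o b)%VF)].

Definition centralised_order K AA b : set A := AA `&` EndK (adjoin K b).

Definition k0 K AA b : \bar int :=
  if `[< adjoin K b = K >] then -oo%E
  else maxz [set k | ~ (NN K AA b k `<=`
         [set x + y | x in centralised_order K AA b & y in jacobson AA])].

Definition simple_stratum K AA (n r : int) b : Prop :=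
  pure_stratum K AA n r b /\ (r%:E < - k0 K AA b)%E.

Definition tame_pure_stratum K AA (n r : int) b : Prop :=
  pure_stratum K AA n r b /\ tamely_ramified K (adjoin K b).

Definition equivalent_strata K AA (r : int) b1 b2 : Prop :=
  radX K AA (- r) (b1 - b2).

End Strata.

Arguments scalars {F} V.

(* Main.v *)
(* For every field K that contains F and whose nonzero elements shift the chain
   L, the radical filtration of the order of L in End_K(V) is
   P^k = {x : x L_i < L_{i+k}}. Elements of the normaliser of AA shift L, because
   the AA-stable lattices are exactly the L_i; so this applies to K = F[gamma],
   the order B_gamma is hereditary with the same chain, and its radical
   filtration is the trace of that of AA.

   Since gamma is central in End_K(V), beta and c = beta - gamma induce the same
   commutators there. Hence N_k(c, B_gamma) is contained in N_k(beta, AA), which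
   gives k_0(c, B_gamma) <= -r. If c were in P^(1-r), then N_{-r}(beta, AA) would
   be contained in N_{-r}(gamma, AA), thus in B_gamma + P; the B_gamma-component
   of such an element lies in N_{1-r}(beta, AA), thus in B_beta + P, contradicting
   k_0(beta, AA) = -r. *)
From HB Require Import structures.
Require Import Defs.
From mathcomp Require Import all_boot all_order all_algebra.
From mathcomp Require Import boolp classical_sets constructive_ereal.
From mathcomp Require Import zify.

Set Implicit Arguments.
Unset Strict Implicit.
Unset Printing Implicit Defensive.

Import Order.TTheory GRing.Theory Num.Theory.

Local Open Scope classical_set_scope.
Local Open Scope ring_scope.

(** * Induction, jumps and subgroups in the integers *)

Lemma int_ind_up (Q : int -> Prop) (a : int) :
  Q a -> (forall k, Q k -> Q (k + 1)) -> forall k, a <= k -> Q k.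
Proof.
move=> Qa QS k le_ak; have -> : k = a + `|k - a|%N%:Z by lia.
elim: `|k - a|%N => [|m IHm]; first by rewrite addr0.
by rewrite -addn1 PoszD addrA; exact: QS.
Qed.

Lemma int_jump (Q : int -> Prop) (a b : int) :
  a <= b -> Q a -> ~ Q b -> exists k, Q k /\ ~ Q (k + 1).
Proof.
move=> le_ab Qa nQb; apply: contrapT => noj; apply: nQb.
apply: (int_ind_up Qa) => // k Qk.
by apply: contrapT => nQk; apply: noj; exists k.
Qed.

(** Euclidean division by the least positive element shows that it generates. Applied to the shifts
    realised by a field, this produces the period of a chain. *)
Lemma int_subgroup (S : int -> Prop) :
  (forall k l, S k -> S l -> S (k - l)) -> (exists2 k, 0 < k & S k) ->
  exists2 d, 0 < d & forall k, S k <-> exists q, k = q * d.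
Proof.
move=> SB [k0 k0gt0 Sk0].
have ex : exists n, (0 < n)%N && `[< S n%:Z >].
  by exists `|k0|%N; apply/andP; split; [lia | apply/asboolP; rewrite gtz0_abs].
have [n /andP[n0 /asboolP Sn] minn] := ex_minnP ex.
have S0 : S 0 by rewrite -(subrr k0); exact: SB.
have SN k : S k -> S (- k) by rewrite -[- k]add0r; exact: SB.
have SD k l : S k -> S l -> S (k + l).
  by move=> Sk /SN Sl; rewrite -[l]opprK; exact: SB.
have Sq q : S (q * n%:Z).
  have Snat (m : nat) : S (m%:Z * n%:Z).
    elim: m => [|m IHm]; first by rewrite mul0r.
    by rewrite -addn1 PoszD mulrDl mul1r; exact: SD.
  by case: (intP q) => [|m|m]; rewrite ?mulNr; [exact: Snat 0%N | | apply: SN].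
exists n%:Z => [|k]; first by lia.
split=> [Sk|[q ->]//]; exists (k %/ n%:Z)%Z.
have Sr : S (k %% n%:Z)%Z.
  have -> : (k %% n%:Z)%Z = k - (k %/ n%:Z)%Z * n%:Z by lia.
  exact: SB.
have rge0 : 0 <= (k %% n%:Z)%Z by apply: modz_ge0; lia.
have rlt : (k %% n%:Z)%Z < n%:Z by apply: ltz_pmod; lia.
suff r0 : (k %% n%:Z)%Z = 0 by rewrite {1}(divz_eq k n%:Z) r0 addr0.
apply: contrapT => rn0; have := minn `|(k %% n%:Z)%Z|%N.
have er : `|(k %% n%:Z)%Z|%N%:Z = (k %% n%:Z)%Z by lia.
rewrite er => H; have : (n <= `|(k %% n%:Z)%Z|)%N.
  by apply: H; apply/andP; split; [lia | exact/asboolP].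
by lia.
Qed.

(** * Fields inside the endomorphism algebra *)

Section Subfields.
Variables (F : naLocalFieldType) (V : vectType F) (K : set 'End(V)).
Hypothesis Kf : is_field K.
Local Notation A := 'End(V).
Implicit Types x y : A.

Lemma field1 : K \1%VF. Proof. by case: Kf => -[]. Qed.
Lemma field1_neq0 : (\1%VF : A) != 0. Proof. by case: Kf => -[]. Qed.
Lemma fieldB x y : K x -> K y -> K (x - y). Proof. by case: Kf => _ + _ _ _; exact. Qed.
Lemma field0 : K 0. Proof. by rewrite -(subrr \1%VF); apply: fieldB; exact: field1. Qed.
Lemma fieldN x : K x -> K (- x).
Proof. by rewrite -[- x]add0r; apply: fieldB; exact: field0. Qed.
Lemma fieldD x y : K x -> K y -> K (x + y).
Proof. by move=> Kx /fieldN Ky; rewrite -[y]opprK; exact: fieldB. Qed.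
Lemma fieldM x y : K x -> K y -> K (x \o y)%VF.
Proof. by case: Kf => _ _ + _ _; exact. Qed.
Lemma fieldC x y : K x -> K y -> (x \o y)%VF = (y \o x)%VF.
Proof. by case: Kf => _ _ _ + _; exact. Qed.
Lemma fieldCE x y v : K x -> K y -> x (y v) = y (x v).
Proof. by move=> Kx Ky; rewrite -!comp_lfunE fieldC. Qed.
Lemma fieldV x : K x -> x != 0 ->
  exists y, [/\ K y, y != 0, cancel x y & cancel y x].
Proof.
move=> Kx x0; case: Kf => _ _ _ _ /(_ x Kx x0)[y Ky xy]; exists y.
have yx : (y \o x)%VF = \1%VF by rewrite fieldC.
split=> // [|v|v]; rewrite -?comp_lfunE ?xy ?yx ?id_lfunE //.
by apply: contra field1_neq0 => /eqP y0; rewrite -xy y0 comp_lfun0r.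
Qed.

End Subfields.

(** * Lattice chains *)

Section Chains.
Variables (F : naLocalFieldType) (V : vectType F).
Local Notation A := 'End(V).
Implicit Types (K : set A) (L : int -> set V) (x y : A) (i k : int).

(* For invertible [x] this says [x (L i) = L (i + k)] for all [i]. *)
Definition shift L x k := forall i v, L i v <-> L (i + k) (x v).

Definition stab K L : set A := [set c | K c /\ forall i v, L i v -> L i (c v)].

Definition gens K L i N (t : 'I_N -> V) : Prop :=
  (forall j, L i (t j)) /\
  forall w, L i w -> exists c : 'I_N -> A,
    (forall j, stab K L (c j)) /\ w = \sum_j c j (t j).

(* The k-th power of the radical of the order of [L]; see [radX_filt]. *)
Definition filt K L k : set A :=
  [set x | EndK K x /\ forall i v, L i v -> L (i + k) (x v)].

(* The properties of a lattice chain that determine the powers of the radical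
   of its order. The integers of [K] are encoded as [stab K L], so that passing
   from F to a field normalising the chain needs no valuation theory. *)
Record periodic_chain K L : Prop := PeriodicChain {
  pc_field : is_field K;
  pc_scal : scalars V `<=` K;
  pc_B : forall i v w, L i v -> L i w -> L i (v - w);
  pc_dec : forall i v, L (i + 1) v -> L i v;
  pc_strict : forall i, exists2 v, L i v & ~ L (i + 1) v;
  pc_exh : forall w, exists i, L i w;
  pc_shift : forall x, K x -> x != 0 -> exists k, shift L x k;
  pc_pos : exists x k, [/\ K x, x != 0, 0 < k & shift L x k];
  pc_gens : forall i, exists N (t : 'I_N -> V), gens K L i t }.

Section PeriodicChain.
Variables (K : set A) (L : int -> set V).
Hypothesis H : periodic_chain K L.
Let Kf := pc_field H.

Lemma chain0 i : L i 0.
Proof. by have [v Lv _] := pc_strict H i; rewrite -(subrr v); exact: (pc_B H). Qed.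
Lemma chainN i v : L i v -> L i (- v).
Proof. by rewrite -[- v]add0r; apply: (pc_B H); exact: chain0. Qed.
Lemma chainD i v w : L i v -> L i w -> L i (v + w).
Proof. by move=> Lv /chainN Lw; rewrite -[w]opprK; exact: (pc_B H). Qed.
Lemma chain_sum i (I : Type) (s : seq I) (f : I -> V) :
  (forall j, L i (f j)) -> L i (\sum_(j <- s) f j).
Proof.
by move=> Lf; elim/big_rec: _ => [|j v _]; [exact: chain0 | exact: chainD].
Qed.

Lemma chain_le i j v : i <= j -> L j v -> L i v.
Proof.
move=> le_ij; apply: (int_ind_up (Q := fun j => L j v -> L i v) _ _ le_ij) => //.
by move=> k IHk /(pc_dec H).
Qed.

Lemma chain_sub_le i j : (forall v, L i v -> L j v) -> j <= i.
Proof.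
move=> sub; have [v Lv nLv] := pc_strict H i.
rewrite leNgt; apply/negP => lt_ij; apply: nLv.
by apply: chain_le (sub v Lv); lia.
Qed.

Lemma chain_inj i j : (forall v, L i v <-> L j v) -> i = j.
Proof.
move=> eqL; apply/eqP; rewrite eq_le.
by rewrite !chain_sub_le // => v /eqL.
Qed.

Lemma shift1 : shift L \1%VF 0.
Proof. by move=> i v; rewrite id_lfunE addr0. Qed.

Lemma shift_comp x y k l : shift L x k -> shift L y l -> shift L (x \o y)%VF (k + l).
Proof.
move=> sx sy i v; rewrite comp_lfunE [k + l]addrC addrA.
exact: iff_trans (sy i v) (sx _ _).
Qed.

Lemma shiftV x y k : cancel y x -> shift L x k -> shift L y (- k).
Proof. by move=> yK sx i v; rewrite (sx (i - k)) subrK yK. Qed.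

(** The shifts by nonzero elements of [K] form a subgroup of the integers, nonzero by [pc_pos]. Its
    positive generator [d] is the period of the chain over [K]. *)
Lemma period_exists : exists d, [/\ 0 < d,
  forall q, exists x, [/\ K x, x != 0 & shift L x (q * d)] &
  forall x k, K x -> x != 0 -> shift L x k -> exists q, k = q * d].
Proof.
pose S k := exists x, [/\ K x, x != 0 & shift L x k].
have SB k l : S k -> S l -> S (k - l).
  move=> [x [Kx x0 sx]] [y [Ky y0 sy]].
  have [z [Kz z0 yK zK]] := fieldV Kf Ky y0.
  exists (x \o z)%VF; split; first exact: fieldM.
    apply: contra x0 => /eqP xz; apply/eqP/lfunP => v.
    by rewrite -[v in LHS]yK -comp_lfunE xz !zero_lfunE.
  by apply: shift_comp => //; exact: shiftV sy.
have Spos : exists2 k, 0 < k & S k.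
  by have [x [k [Kx x0 k0 sx]]] := pc_pos H; exists k => //; exists x.
have [d d0 SP] := int_subgroup SB Spos; exists d; split=> // [q|y l Ky y0 sy].
  by apply/SP; exists q.
by apply/SP; exists y.
Qed.

End PeriodicChain.
End Chains.

(** * The stabiliser ring and bases of the lattices *)

Section Stabiliser.
Variables (F : naLocalFieldType) (V : vectType F).
Variables (K : set 'End(V)) (L : int -> set V).
Hypothesis H : periodic_chain K L.
Local Notation A := 'End(V).
Local Notation O := (stab K L).
Implicit Types (x y : A) (i k : int).
Let Kf := pc_field H.

Lemma stab_sub x : O x -> K x. Proof. by case. Qed.
Lemma stabE x i v : O x -> L i v -> L i (x v). Proof. by move=> [_ Ox]; exact: Ox. Qed.
Lemma stab0 : O 0.
Proof. by split=> [|i v _]; [exact: field0 | rewrite zero_lfunE; exact: (chain0 H)]. Qed.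
Lemma stabB x y : O x -> O y -> O (x - y).
Proof.
move=> [Kx Ox] [Ky Oy]; split=> [|i v Lv]; first exact: fieldB.
by rewrite add_lfunE opp_lfunE; apply: (pc_B H); [exact: Ox | exact: Oy].
Qed.
Lemma stabM x y : O x -> O y -> O (x \o y)%VF.
Proof.
move=> [Kx Ox] [Ky Oy]; split=> [|i v Lv]; first exact: fieldM.
by rewrite comp_lfunE; apply: Ox; exact: Oy.
Qed.

Lemma shift_stab x k : K x -> shift L x k -> O x <-> 0 <= k.
Proof.
move=> Kx sx; split=> [[_ Ox]|k0].
  (* If [k < 0], then [x v] lies in [L 0], hence in [L (1 + k)], and the shift property at index 1
     would put [v] in [L 1]. *)
  have [v Lv nLv] := pc_strict H 0.
  rewrite leNgt; apply/negP => k_lt0; apply: nLv; rewrite (sx 1).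
  by apply: (chain_le H _ (Ox _ _ Lv)); lia.
by split=> // i v Lv; apply: (chain_le H (j := i + k)); [lia | exact: (sx i v).1].
Qed.

Lemma stab_gens i (I : finType) (t : I -> V) (c : I -> A) :
  (forall j, L i (t j)) -> (forall j, O (c j)) -> L i (\sum_j c j (t j)).
Proof. by move=> Lt Oc; apply: (chain_sum H) => // j; exact: stabE. Qed.

(* Take a generating family of minimal size: in a nontrivial linear relation,
   dividing by a coefficient of minimal shift makes one generator redundant. *)
Lemma lattice_basis i : exists N (t : 'I_N -> V), gens K L i t /\
  forall c : 'I_N -> A, (forall j, K (c j)) -> \sum_j c j (t j) = 0 ->
    forall j, c j = 0.
Proof.
have ex : exists N, `[< exists t : 'I_N -> V, gens K L i t >].
  by have [N gN] := pc_gens H i; exists N; apply/asboolP.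
have [N /asboolP[t [Lt gt]] minN] := ex_minnP ex; exists N, t; split=> // c Kc ct.
apply: contrapT => /existsNP[j0 /eqP c0].
pose sh x := xget 0 [set k | shift L x k].
have shP x : K x -> x != 0 -> shift L x (sh x).
  by move=> Kx x0; exact: xgetPex (pc_shift H Kx x0).
case: (@arg_minP _ _ _ j0 (fun j => c j != 0) (fun j => sh (c j)) c0) => j cj0 minj.
have [y [Ky y0 cK yK]] := fieldV Kf (Kc j) cj0.
(* [c j] has the least shift among the nonzero coefficients, so every quotient by it has nonnegative
   shift. *)
have Oyc l : O (y \o c l)%VF.
  have [->|cl0] := eqVneq (c l) 0; first by rewrite comp_lfun0r; exact: stab0.
  apply/(@shift_stab _ (- sh (c j) + sh (c l))); first exact: fieldM.
    by apply: shift_comp; [apply: shiftV yK _; exact: shP | exact: shP].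
  by have := minj l cl0; lia.
have [N' eN] : exists N', N = N'.+1.
  by exists N.-1; rewrite prednK // (leq_ltn_trans _ (ltn_ord j0)).
subst N.
have tj : t j = - \sum_l (y \o c (lift j l))%VF (t (lift j l)).
  apply/eqP; rewrite -subr_eq0 opprK -[t j]cK; apply/eqP.
  under eq_bigr do rewrite comp_lfunE.
  rewrite -linear_sum -linearD.
  by move: ct; rewrite (bigD1_ord j) //= => ->; rewrite linear0.
suff /minN : `[< exists t : 'I_N' -> V, gens K L i t >] by rewrite ltnn.
apply/asboolP; exists (t \o lift j); split=> [l|w /gt[a [Oa ->]]]; first exact: Lt.
exists (fun l => a (lift j l) - (a j \o (y \o c (lift j l)))%VF); split=> [l|].
  by apply: stabB => //; exact: stabM.
rewrite (bigD1_ord j) //= tj linearN linear_sum /= addrC -sumrB.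
by apply: eq_bigr => l _; rewrite add_lfunE opp_lfunE !comp_lfunE.
Qed.

End Stabiliser.

(** * Coordinates, separation and rank-one endomorphisms *)

Section Filtration.
Variables (F : naLocalFieldType) (V : vectType F).
Variables (K : set 'End(V)) (L : int -> set V).
Hypothesis H : periodic_chain K L.
Local Notation A := 'End(V).
Local Notation O := (stab K L).
Implicit Types (x y : A) (i k : int).
Let Kf := pc_field H.

Lemma scalar_in (a : F) : K (a *: \1%VF).
Proof. by apply: (pc_scal H); exists a. Qed.

(** These are the coordinates on a basis of [L i] over the stabiliser ring, which is also a
    [K]-basis of [V]. Uniqueness of the expansion gives linearity. Linearity over F is recorded
    because [rank_one] builds an F-linear map from a coordinate. *)
Lemma chain_coordinates i : exists N (C : V -> 'I_N -> A),
  [/\ forall w j, K (C w j),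
     forall j, linear (fun w => C w j),
     forall x w j, K x -> C (x w) j = (x \o C w j)%VF,
     forall w, L i w <-> forall j, O (C w j) &
     forall w, (forall j, C w j = 0) -> w = 0].
Proof.
have [N [t [[Lt gt] free_t]]] := lattice_basis H i.
have [d [d0 exd _]] := period_exists H.
(* An element of [K] of large shift brings [w] into [L i]; the coefficients found there are then
   divided by it. *)
have span w : exists c : 'I_N -> A, (forall j, K (c j)) /\ w = \sum_j c j (t j).
  have [k Lw] := pc_exh H w.
  have [x [Kx x0 sx]] := exd `|i - k|%N%:Z.
  have [y [Ky y0 xK yK]] := fieldV Kf Kx x0.
  have /gt[c [Oc xw]] : L i (x w).
    by apply: (chain_le H (j := k + `|i - k|%N%:Z * d)); [nia | exact: (sx k w).1].
  exists (fun j => (y \o c j)%VF); split=> [j|].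
    by apply: fieldM => //; exact: stab_sub.
  under eq_bigr do rewrite comp_lfunE.
  by rewrite -linear_sum /= -xw xK.
have [C CP] := choice span.
have uniqC w (c : 'I_N -> A) : (forall j, K (c j)) -> w = \sum_j c j (t j) -> C w = c.
  move=> Kc ew; apply/funext => j; apply/eqP; rewrite -subr_eq0; apply/eqP.
  apply: (free_t (fun j => C w j - c j)) => [l|].
    by apply: fieldB => //; case: (CP w).
  under eq_bigr do rewrite add_lfunE opp_lfunE.
  by rewrite sumrB -ew -(CP w).2 subrr.
exists N, C; split=> [w||x w j Kx|w|w C0].
- by case: (CP w).
- move=> j a u v; rewrite (uniqC _ (fun j => a *: C u j + C v j)) // => [l|].
    apply: fieldD => //; last by case: (CP v).
    have -> : a *: C u l = ((a *: \1%VF) \o C u l)%VF by rewrite -comp_lfunZl comp_lfun1l.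
    by apply: fieldM => //; [exact: scalar_in | case: (CP u)].
  rewrite {1}(CP u).2 {1}(CP v).2 scaler_sumr -big_split.
  by apply: eq_bigr => l _; rewrite add_lfunE scale_lfunE.
- rewrite (uniqC _ (fun j => (x \o C w j)%VF)) // => [l|].
    by apply: fieldM => //; case: (CP w).
  rewrite {1}(CP w).2 linear_sum.
  by apply: eq_bigr => l _; rewrite comp_lfunE.
- split=> [/gt[c [Oc ew]] j|OC]; first by rewrite (uniqC _ c) // => l; exact: stab_sub.
  by rewrite (CP w).2; exact: (stab_gens H).
- by rewrite (CP w).2 big1 // => j _; rewrite C0 zero_lfunE.
Qed.

Lemma chain_separated w : w != 0 -> exists k, L k w /\ ~ L (k + 1) w.
Proof.
move=> w0; have [k0 Lk0] := pc_exh H w.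
have [d [d0 exd _]] := period_exists H.
have [N [C [KC _ CM CO C0]]] := chain_coordinates 0.
suff [k nLk] : exists k, ~ L k w.
  have [le_k|lt_k] := leP k0 k; first exact: (int_jump (Q := fun k => L k w) le_k).
  by case: nLk; apply: (chain_le H _ Lk0); exact: ltW.
have [j Cj0] : exists j, C w j != 0.
  apply: contrapT => noj; move/eqP: w0; apply; apply: C0 => j.
  by apply/eqP; apply: contrapT => /negP Cj; apply: noj; exists j.
have [s sC] := pc_shift H (KC w j) Cj0.
(* If [w] had this level, an element of the opposite shift would bring it into [L 0]. The nonzero
   coordinate would then have shift [s - (|s| + 1) d], which is negative. *)
exists ((`|s| + 1)%N%:Z * d) => Lw.
have [x [Kx x0 sx]] := exd (- (`|s| + 1)%N%:Z).
have /CO/(_ j) : L 0 (x w).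
  have := (sx ((`|s| + 1)%N%:Z * d) w).1 Lw.
  by rewrite mulNr subrr.
rewrite CM //; apply/(shift_stab H _ (shift_comp sx sC)); first exact: fieldM.
by apply/negP; rewrite -ltNge; nia.
Qed.

(** The map is [w |-> a C(w) v], where [C] is a coordinate that does not vanish at [u] and [a] is
    the inverse of its value there. The level of [u] being exactly [i] allows a coordinate of shift
    0, so that dividing by it costs no level. *)
Lemma rank_one i j u v : L i u -> ~ L (i + 1) u -> L j v ->
  exists b, [/\ filt K L (j - i) b, b u = v & forall w, exists2 c, K c & b w = c v].
Proof.
move=> Lu nLu Lv; have [d [d0 exd perd]] := period_exists H.
(* The base [i + 1 - d] is one period below [i + 1]. If no coordinate of [u] had shift 0, all
   nonzero ones would have shift at least [d], the shifts being multiples of [d], and [u] would lie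
   in [L (i + 1)]. *)
have [N [C [KC linC CM CO C0]]] := chain_coordinates (i + 1 - d).
have OCu m : O (C u m) by apply: (CO u).1; apply: (chain_le H _ Lu); lia.
have [m Cm0 sm] : exists2 m, C u m != 0 & shift L (C u m) 0.
  apply: contrapT => nom; apply: nLu.
  have [x [Kx x0 sx]] := exd (-1).
  rewrite (sx (i + 1)) mulN1r; apply/CO => m; rewrite CM //.
  have [Cu0|Cu0] := eqVneq (C u m) 0; first by rewrite Cu0 comp_lfun0r; exact: (stab0 H).
  have [s sC] := pc_shift H (KC u m) Cu0.
  apply/(shift_stab H _ (shift_comp sx sC)); first exact: fieldM.
  have s0 : 0 <= s by apply/(shift_stab H (KC u m) sC).
  have [q es] := perd _ _ (KC u m) Cu0 sC.
  have : s != 0 by apply/eqP => s_0; apply: nom; exists m; rewrite // -s_0.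
  move=> sn0; have q1 : 1 <= q by nia.
  by nia.
have [a [Ka a0 CK aK]] := fieldV Kf (KC u m) Cm0.
have sa : shift L a 0 by rewrite -oppr0; exact: shiftV sm.
have Oa : O a by apply/(shift_stab H Ka sa).
pose bf w := (a \o C w m)%VF v.
have lin_b : linear bf.
  move=> k w w'; rewrite /bf linC !comp_lfunE add_lfunE scale_lfunE.
  by rewrite linearD linearZ.
pose b0 : {linear V -> V} := HB.pack bf (GRing.isLinear.Build F V V *:%R bf lin_b).
have bE w : linfun b0 w = a (C w m v) by rewrite lfunE /= /bf comp_lfunE.
have bK c w : K c -> linfun b0 (c w) = c (linfun b0 w).
  by move=> Kc; rewrite !bE CM // comp_lfunE (fieldCE Kf).
exists (linfun b0); split.
- split=> [c Kc w|l w Lw]; first exact: bK.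
  (* With the floor of [(i - l) / d], the vector [x w] reaches level [i + 1 - d], where coordinates
     are integral, and undoing [x] loses at most [i - l] levels from [j]. *)
  have [x [Kx x0 sx]] := exd ((i - l) %/ d)%Z.
  have Oxw : O (C (x w) m).
    apply: (CO _).1; apply: (chain_le H _ ((sx _ _).1 Lw)).
    by have := divz_eq (i - l) d; have := ltz_pmod (i - l) d0; lia.
  have : L j (x (linfun b0 w)).
    by rewrite -bK // bE; apply: (stabE Oa); exact: (stabE Oxw).
  have -> : j = j - ((i - l) %/ d)%Z * d + ((i - l) %/ d)%Z * d by lia.
  move/(sx _ _).2; apply: (chain_le H).
  by have := divz_eq (i - l) d; have := modz_ge0 (i - l) (lt0r_neq0 d0); lia.
- by rewrite bE CK.
- by move=> w; exists (a \o C w m)%VF; [exact: fieldM | rewrite bE comp_lfunE].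
Qed.

End Filtration.

(** * The radical filtration *)

Section Radical.
Variables (F : naLocalFieldType) (V : vectType F).
Variables (K : set 'End(V)) (L : int -> set V).
Hypothesis H : periodic_chain K L.
Local Notation A := 'End(V).
Implicit Types (x y p q b : A) (i j k : int).

Lemma filt0 k : filt K L k 0.
Proof.
split=> [c _ v|i v _]; rewrite !zero_lfunE ?linear0 //; exact: (chain0 H _).
Qed.
Lemma filt1 : filt K L 0 \1%VF.
Proof. by split=> [c _ v|i v]; rewrite !id_lfunE ?addr0. Qed.
Lemma filtB k x y : filt K L k x -> filt K L k y -> filt K L k (x - y).
Proof.
move=> [Cx Lx] [Cy Ly]; split=> [c Kc v|i v Lv].
  by rewrite !add_lfunE !opp_lfunE Cx // Cy // linearB.
by rewrite add_lfunE opp_lfunE; apply: (pc_B H); [exact: Lx | exact: Ly].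
Qed.
Lemma filtD k x y : filt K L k x -> filt K L k y -> filt K L k (x + y).
Proof.
move=> fx fy; rewrite -[y]opprK -[- y]add0r; do 2! apply: filtB => //.
exact: filt0.
Qed.
Lemma filtM k l x y : filt K L k x -> filt K L l y -> filt K L (k + l) (x \o y)%VF.
Proof.
move=> [Cx Lx] [Cy Ly]; split=> [c Kc v|i v Lv]; rewrite !comp_lfunE.
  by rewrite Cy // Cx.
by rewrite [k + l]addrC addrA; apply: Lx; exact: Ly.
Qed.
Lemma filt_le k l x : k <= l -> filt K L l x -> filt K L k x.
Proof.
move=> le_kl [Cx Lx]; split=> // i v /Lx; apply: (chain_le H); lia.
Qed.
Lemma filt0M k x y : filt K L 0 x -> filt K L k y -> filt K L k (x \o y)%VF.
Proof. by move=> fx fy; rewrite -[k]add0r; exact: filtM. Qed.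
Lemma filtM0 k x y : filt K L k x -> filt K L 0 y -> filt K L k (x \o y)%VF.
Proof. by move=> fx fy; rewrite -[k]addr0; exact: filtM. Qed.

(* [1 - p] is injective, since a nonzero [w = p w] of exact level [k] would lie
   in [L (k + 1)]; its inverse preserves levels for the same reason. *)
Lemma filt_unipotent p : filt K L 1 p ->
  exists2 q, filt K L 0 q & (q \o (\1 - p) = \1)%VF.
Proof.
move=> [Cp Lp].
have ker0 : lker (\1%VF - p) == 0%VS.
  rewrite -subv0; apply/subvP => w; rewrite memv_ker memv0.
  rewrite add_lfunE opp_lfunE id_lfunE subr_eq0 => /eqP ew.
  apply: contrapT => /negP w0.
  by have [k [Lw nLw]] := chain_separated H w0; apply: nLw; rewrite ew; exact: Lp.
exists (\1%VF - p)^-1%VF; last exact: lker0_compVf.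
have inv v : (\1%VF - p) ((\1%VF - p)^-1%VF v) = v by exact: lker0_lfunVK.
split=> [c Kc v|i v Lv].
  apply: (lker0P ker0); rewrite inv add_lfunE opp_lfunE id_lfunE Cp // -linearB.
  by rewrite -[X in X - _]id_lfunE -opp_lfunE -add_lfunE inv.
set w := (\1%VF - p)^-1%VF v; rewrite addr0.
have [->|w0] := eqVneq w 0; first exact: (chain0 H _).
have [k [Lw nLw]] := chain_separated H w0.
have [le_ik|lt_ki] := leP i k; first exact: (chain_le H le_ik Lw).
have ew : w = v + p w.
  by have := inv v; rewrite -/w add_lfunE opp_lfunE id_lfunE => <-; rewrite subrK.
case: nLw; rewrite ew; apply: (chainD H); last exact: Lp.
by apply: (chain_le H _ Lv); lia.
Qed.

Lemma jacobson_filt : jacobson (filt K L 0) = filt K L 1.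
Proof.
apply/seteqP; split=> [x [fx rad_x]|x fx].
  split=> [|i v Lv]; first by case: fx.
  apply: contrapT => nLxv.
  have nLv : ~ L (i + 1) v.
    by move=> Lv1; apply: nLxv; have := fx.2 _ _ Lv1; rewrite addr0.
  (* [I] is a maximal left ideal: an element outside it sends [v] to another vector of exact level
     [i], and a rank-one map brings that vector back to [v]. *)
  pose I := [set a | filt K L 0 a /\ L (i + 1) (a v)].
  suff /rad_x [] : maximal_left_ideal (filt K L 0) I by [].
  split; first split.
  - by move=> a [].
  - by split; [exact: filt0 | rewrite zero_lfunE; exact: (chain0 H _)].
  - move=> a b [fa La] [fb Lb]; split; first exact: filtD.
    by rewrite add_lfunE; exact: (chainD H).
  - move=> a b fa [fb Lb]; split; first exact: filt0M.
    by rewrite comp_lfunE -[i + 1]addr0; exact: fa.2.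
  - move=> eI; have : I \1%VF by rewrite eI; exact: filt1.
    by case=> _; rewrite id_lfunE.
  move=> J [JA J0 JD JM] IJ.
  have [[a Ja nLa]|noa] := pselect (exists2 a, J a & ~ L (i + 1) (a v)).
    right; apply/seteqP; split=> // b fb.
    have Lav : L i (a v) by have := (JA a Ja).2 _ _ Lv; rewrite addr0.
    have [c [fc ec _]] := rank_one H Lav nLa Lv.
    rewrite subrr in fc.
    have Jca : J (c \o a)%VF by exact: JM.
    have I1 : I (\1%VF - (c \o a)%VF).
      split; first by apply: filtB; [exact: filt1 | apply: filt0M => //; exact: JA].
      rewrite add_lfunE opp_lfunE id_lfunE comp_lfunE ec subrr; exact: (chain0 H _).
    rewrite -[b]comp_lfun1r; apply: JM => //.
    by rewrite -[\1%VF](subrK (c \o a)%VF); apply: JD => //; exact: IJ.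
  left; apply/seteqP; split=> // a Ja; split; first exact: JA.
  by apply: contrapT => nLa; apply: noa; exists a.
split=> [|I [[IA I0 ID IM] InA maxI]]; first exact: filt_le fx.
apply: contrapT => nIx; apply: InA.
(* If [x] were not in [I], then [J = I + A x] would be the whole order, so [1 = a + b x] with [a] in
   [I]. As [b x] raises levels by 1, [a] has a left inverse and [I] is not proper. *)
pose J := [set z | exists a b, [/\ I a, filt K L 0 b & z = a + (b \o x)%VF]].
have Jleft : left_ideal (filt K L 0) J.
  split.
  - move=> _ [a [b [Ia fb ->]]]; apply: filtD; first exact: IA.
    by apply: filt0M => //; exact: filt_le fx.
  - by exists 0, 0; split=> //; [exact: filt0 | rewrite comp_lfun0l addr0].
  - move=> _ _ [a [b [Ia fb ->]]] [a' [b' [Ia' fb' ->]]].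
    exists (a + a'), (b + b'); split; [exact: ID | exact: filtD |].
    by rewrite comp_lfunDl addrACA.
  - move=> c _ fc [a [b [Ia fb ->]]].
    exists (c \o a)%VF, (c \o b)%VF; split; [exact: IM | exact: filt0M |].
    by rewrite comp_lfunDr comp_lfunA.
have IJ : I `<=` J.
  move=> a Ia; exists a, 0; split=> //; first exact: filt0.
  by rewrite comp_lfun0l addr0.
case: (maxI J Jleft IJ) => eJ.
  case: nIx; rewrite -eJ; exists 0, \1%VF; split=> //; first exact: filt1.
  by rewrite comp_lfun1l add0r.
have : J \1%VF by rewrite eJ; exact: filt1.
case=> a [b [Ia fb e1]].
have [q fq eq] : exists2 q, filt K L 0 q & (q \o a = \1)%VF.
  have -> : a = \1%VF - (b \o x)%VF by rewrite e1 addrK.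
  by apply: filt_unipotent; exact: filt0M.
apply/seteqP; split=> // c fc.
by rewrite -[c]comp_lfun1r -eq; exact: (IM _ _ fc (IM _ _ fq Ia)).
Qed.

(** The image lies in a single [K]-line, so a product starting with [b] is determined by what the
    later factors do to [w]. *)
Definition thin b : Prop :=
  filt K L 0 b /\
  exists2 w, w != 0 & forall v, exists2 c, K c & b v = c w.

(* A splitting of the chain into lines, encoded by its projections. *)
Lemma thin_decomposition q : filt K L 0 q -> (q \o q)%VF = q ->
  exists2 s : seq A, {in s, forall b, thin b} & q = \sum_(b <- s) b.
Proof.
move: {2}(\dim (limg q)).+1 (ltnSn (\dim (limg q))) => n.
elim: n q => // n IHn q le_n fq qq.
have [q0|/lfunPn[v]] := eqVneq q 0; first by exists [::]; rewrite ?big_nil.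
rewrite zero_lfunE; set w := q v => w0.
have [k [Lw nLw]] := chain_separated H w0.
have [b0 [fb0 b0w b0K]] := rank_one H Lw nLw Lw.
rewrite subrr in fb0.
have qw : q w = w by rewrite -comp_lfunE qq.
(* Composing with [q] makes [b] an idempotent with [q b = b q = b]. Hence [q - b] is idempotent, and
   its image is strictly smaller because it kills [w]. *)
pose b := (b0 \o q)%VF.
have fb : filt K L 0 b by exact: filt0M.
have bw : b w = w by rewrite comp_lfunE qw.
have bK u : exists2 c, K c & b u = c w.
  by have [c Kc e] := b0K (q u); exists c; rewrite ?comp_lfunE.
have qb : (q \o b)%VF = b.
  apply/lfunP => u; rewrite comp_lfunE; have [c Kc ->] := bK u.
  by rewrite fq.1 // qw.
have bq : (b \o q)%VF = b by rewrite -comp_lfunA qq.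
have bb : (b \o b)%VF = b.
  apply/lfunP => u; rewrite comp_lfunE; have [c Kc ->] := bK u.
  by rewrite fb.1 // bw.
have qq' : (q \o (q - b))%VF = q - b by rewrite comp_lfunDr comp_lfunNr qq qb.
have q'q' : ((q - b) \o (q - b))%VF = q - b.
  by rewrite comp_lfunDl qq' comp_lfunNl comp_lfunDr comp_lfunNr bq bb subrr subr0.
have sub_im : (limg (q - b) <= limg q)%VS.
  by rewrite -qq' limg_comp limgS // subvf.
have lt_n : (\dim (limg (q - b)%R) < n)%N.
  apply: leq_trans (le_n : (\dim (limg q) <= n)%N).
  rewrite ltn_neqAle dimvS // andbT.
  apply: contra w0 => /eqP ed.
  have : w \in limg (q - b).
    have /eqP-> : limg (q - b) == limg q by rewrite eqEdim sub_im ed leqnn.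
    exact: memv_img (memvf v).
  case/memv_imgP => u _ ew; have : (q - b) w = w by rewrite {1}ew -comp_lfunE q'q' -ew.
  by rewrite add_lfunE opp_lfunE qw bw subrr => <-.
have [s thin_s es] := IHn (q - b) lt_n (filtB fq fb) q'q'.
exists (b :: s) => [c|]; last by rewrite big_cons -es addrC subrK.
by rewrite inE => /predU1P[->|/thin_s//]; split=> //; exists w.
Qed.

(** For the harder inclusion the identity is split into thin maps [b]. The vector [w] spanning the
    line of [b] is sent by [z] to a vector [u] exactly [m] levels higher, and [y] sends [u] to
    [x w], one level further. Thus [x b = y z b]. *)
Lemma ideal_exp_filt m : ideal_exp (filt K L 0) (filt K L 1) m = filt K L m%:Z.
Proof.
elim: m => // m IHm; rewrite /ideal_exp iterS -/(ideal_exp _ _ m) IHm.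
apply/seteqP; split=> [_ [s sP ->]|x fx].
  elim: s sP => [|z s IHs] sP; first by rewrite big_nil; exact: filt0.
  rewrite big_cons; apply: filtD; last first.
    by apply: IHs => y ys; apply: sP; rewrite inE ys orbT.
  have [a fa [b fb <-]] := sP z (mem_head _ _).
  by rewrite -[m.+1%:Z]/(1 + m%:Z); exact: filtM.
have [s thin_s e1] := thin_decomposition filt1 (comp_lfun1r _).
exists [seq (x \o b)%VF | b <- s]; last first.
  rewrite big_map -[x in LHS]comp_lfun1r e1.
  by elim/big_rec2: _ => [|b y z _ <-]; rewrite ?comp_lfun0r ?comp_lfunDr.
move=> _ /mapP[b /thin_s[fb [w w0 bK]] ->].
have [k [Lw nLw]] := chain_separated H w0.
have [u Lu nLu] := pc_strict H (k + m%:Z).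
have [z [fz zw _]] := rank_one H Lw nLw Lu.
have Lxw : L (k + m%:Z + 1) (x w).
  by have := fx.2 _ _ Lw; rewrite -addn1 PoszD addrA.
have [y [fy yu _]] := rank_one H Lu nLu Lxw.
exists y; first by move: fy; rewrite addrC addKr.
exists (z \o b)%VF; first by apply: filtM0 => //; move: fz; rewrite addrC addKr.
apply/lfunP => v; rewrite !comp_lfunE; have [c Kc ->] := bK v.
by rewrite fz.1 // fy.1 // fx.1 // zw yu.
Qed.

Lemma radX_filt k : radX K (filt K L 0) k = filt K L k.
Proof.
case: k => m; rewrite /radX jacobson_filt ideal_exp_filt //.
apply/seteqP; split=> [x [Cx Px]|x fx]; last first.
  split=> [|y fy]; first by case: fx.
  by split; [have := filtM fx fy | have := filtM fy fx];
    congr filt; lia.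
(* Here [Negz m] is [-(m + 1)]. The test element [y] of the power [m + 1] carries a vector [u] of
   exact level [i - (m + 1)] to [v], and [x y] preserves the level of [u]. *)
split=> // i v Lv; have [u Lu nLu] := pc_strict H (i + Negz m).
have [y [fy yu _]] := rank_one H Lu nLu Lv.
have [|[_ /(_ _ _ Lu)]] := Px y.
  by move: fy; have -> : i - (i + Negz m) = m.+1%:Z by lia.
by rewrite comp_lfunE yu addr0.
Qed.

End Radical.

(** * Normaliser of the order *)

Section Normaliser.
Variables (F : naLocalFieldType) (V : vectType F).
Variables (K : set 'End(V)) (L : int -> set V).
Hypothesis H : periodic_chain K L.
Local Notation A := 'End(V).
Implicit Types (x y : A) (i k : int).

Lemma family_level (I : finType) (t : I -> V) : exists b, forall j, L b (t j).
Proof.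
have [f fP] := choice (fun j => pc_exh H (t j)).
exists (- \sum_j `|f j|) => j; apply: (chain_le H _ (fP j)).
rewrite lerNl (le_trans (ler_norm _)) // normrN (bigD1 j) //= lerDl.
by apply: sumr_ge0.
Qed.

Lemma EndK_bounded x i : EndK K x -> exists b, forall v, L i v -> L b (x v).
Proof.
move=> Cx; have [N [t [Lt gt]]] := pc_gens H i.
have [b Lb] := family_level (fun j => x (t j)).
exists b => v /gt[c [Oc ->]]; rewrite linear_sum.
apply: (chain_sum H) => j /=; rewrite (Cx _ (stab_sub (Oc j))).
exact: stabE.
Qed.

Lemma EndK_cobounded x i : EndK K x -> exists c, forall v, L c v -> L i (x v).
Proof.
move=> Cx; have [b Lb] := EndK_bounded i Cx.
have [d [d0 exd _]] := period_exists H.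
(* An element of [K] of shift [- |i - b| d] moves this lattice into [L i]. It commutes with [x], and
   undoing it raises the level from [b] to at least [i]. *)
exists (i + `|i - b|%N%:Z * d) => v Lv.
have [z [Kz z0 sz]] := exd (- `|i - b|%N%:Z).
have Lz : L i (z v) by have := (sz _ _).1 Lv; rewrite mulNr addrK.
apply: (chain_le H (j := b + `|i - b|%N%:Z * d)); first by nia.
by apply/(sz _ _).2; rewrite mulNr addrK -Cx //; exact: Lb.
Qed.

(* Any [w] in [M] of exact level [k] generates [L k] over the order. *)
Lemma stable_lattice (M : set V) :
  (forall a v, filt K L 0 a -> M v -> M (a v)) ->
  (exists b, forall v, M v -> L b v) -> (exists c, forall v, L c v -> M v) ->
  exists k, forall v, M v <-> L k v.
Proof.
move=> stM [b Mb] [c Mc].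
have nQ : ~ (forall v, M v -> L (c + 1) v).
  by move=> Mc1; have [v Lv nLv] := pc_strict H c; apply/nLv/Mc1/Mc.
have le_bc : b <= c + 1.
  by have := chain_sub_le H (fun v Lv => Mb v (Mc v Lv)); lia.
have [k [Mk nMk]] := int_jump (Q := fun k => forall v, M v -> L k v) le_bc Mb nQ.
exists k => v; split=> [/Mk//|Lv].
have [w Mw nLw] : exists2 w, M w & ~ L (k + 1) w.
  apply: contrapT => now; apply: nMk => w Mw; apply: contrapT => nLw.
  by apply: now; exists w.
have [a [fa <- _]] := rank_one H (Mk w Mw) nLw Lv.
by apply: stM => //; move: fa; rewrite subrr.
Qed.

(** Each image [x (L i)] is a bounded, cobounded subset stable under the order, hence some [L k].
    The resulting map on indices is a strictly increasing surjection of the integers, hence a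
    translation. *)
Lemma normaliser_shift x : normaliser K (filt K L 0) x -> exists k, shift L x k.
Proof.
move=> [Cx [y [Cy xy yx eA]]].
have yK : cancel y x by move=> v; rewrite -comp_lfunE xy id_lfunE.
have xK : cancel x y by move=> v; rewrite -comp_lfunE yx id_lfunE.
have conj1 a : filt K L 0 a -> filt K L 0 (x \o a \o y)%VF.
  by move=> fa; rewrite -eA; exists a.
have conj2 a : filt K L 0 a -> filt K L 0 (y \o a \o x)%VF.
  rewrite -{1}eA => -[a' fa' <-].
  by rewrite !comp_lfunA yx comp_lfun1l -comp_lfunA yx comp_lfun1r.
have level z z' : EndK K z -> EndK K z' -> cancel z z' -> cancel z' z ->
    (forall a, filt K L 0 a -> filt K L 0 (z' \o a \o z)%VF) ->
    forall i, exists k, forall v, L i v <-> L k (z v).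
  move=> Cz Cz' zK z'K conj i.
  (* [M] is the image of [L i] under [z], described through the inverse [z']. *)
  have [|||k kP] := stable_lattice (M := fun v => L i (z' v)).
  - move=> a v /conj fa Lv; have := fa.2 _ _ Lv.
    by rewrite !comp_lfunE z'K addr0.
  - by have [b bP] := EndK_bounded i Cz; exists b => v /bP; rewrite z'K.
  - by have [c cP] := EndK_cobounded i Cz'; exists c.
  by exists k => v; rewrite -kP zK.
have [f fP] := choice (level x y Cx Cy xK yK conj2).
have [g gP] := choice (level y x Cy Cx yK xK conj1).
have fg k : f (g k) = k.
  by apply: (chain_inj H) => v; rewrite (gP k) (fP (g k)) yK.
have f_lt i : f i < f (i + 1).
  have le : f i <= f (i + 1).
    apply: (chain_sub_le H) => v; rewrite -[v]yK -!fP.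
    exact: (pc_dec H).
  have ne : f i != f (i + 1).
    apply/eqP => e; suff : i = i + 1 by lia.
    by apply: (chain_inj H) => v; rewrite (fP i) (fP (i + 1)) e.
  by lia.
have f_le i j : i <= j -> f i <= f j.
  move=> le_ij; apply: (int_ind_up (Q := fun j => f i <= f j) _ _ le_ij) => // k.
  by have := f_lt k; lia.
(* The integer [f i + 1] is a value of [f], taken at an index above [i], so [f (i + 1)] cannot
   exceed it. *)
have f_S i : f (i + 1) = f i + 1.
  have lt_i : i < g (f i + 1).
    by rewrite ltNge; apply/negP => /f_le; rewrite fg; lia.
  have := f_le (i + 1) (g (f i + 1)); rewrite fg.
  by have := f_lt i; lia.
have f_nat i (n : nat) : f (i + n%:Z) = f i + n%:Z.
  elim: n => [|n IHn]; first by rewrite !addr0.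
  by rewrite -addn1 PoszD !addrA f_S IHn.
exists (f 0) => i v; rewrite (fP i).
suff -> : f i = i + f 0 by [].
have [i0|i0] := leP 0 i.
  by have := f_nat 0 `|i|%N; rewrite add0r gez0_abs // => ->; rewrite addrC.
have := f_nat i `|i|%N; rewrite ltz0_abs // subrr => ->.
by rewrite addrC subrK.
Qed.

Lemma periodic_chain_extend (K' : set A) : is_field K' -> K `<=` K' ->
  (forall x, K' x -> x != 0 -> exists k, shift L x k) -> periodic_chain K' L.
Proof.
move=> K'f subK sh; split=> //.
- by move=> x /(pc_scal H)/subK.
- exact: pc_B H.
- exact: pc_dec H.
- exact: pc_strict H.
- exact: pc_exh H.
- by have [x [k [Kx *]]] := pc_pos H; exists x, k; split=> //; exact: subK.
move=> i; have [N [t [Lt gt]]] := pc_gens H i; exists N, t; split=> // w /gt[c [Oc ->]].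
by exists c; split=> // j; have [Kc Lc] := Oc j; split=> //; exact: subK.
Qed.

End Normaliser.

(** * Lattice chains over F *)

Section Valuation.
Variable F : naLocalFieldType.
Implicit Types a b : F.

Lemma vF0 : vF (0 : F) = +oo%E. Proof. exact/vF_eqy. Qed.

Lemma vF1 : vF (1 : F) = 0%E.
Proof.
have [u vu] := @vF_uniformizer F; have := vFM u 1; rewrite mulr1 vu.
by case: (vF 1) => //= n [e]; congr (_%:E); lia.
Qed.

Lemma vF_fin a : a != 0 -> exists k : int, vF a = k%:E.
Proof.
move=> a0; have := vFM a a^-1; rewrite divff // vF1.
case E : (vF a) => [k||]; first by exists k.
  by move/vF_eqy: E => /eqP; rewrite (negPf a0).
by case: (vF a^-1).
Qed.

Lemma vFV a k : a != 0 -> vF a = k%:E -> vF a^-1 = (- k)%:E.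
Proof.
move=> a0 ak; have := vFM a a^-1; rewrite divff // vF1 ak.
by case: (vF a^-1) => //= n [e]; congr (_%:E); lia.
Qed.

Lemma vFN a : vF (- a) = vF a.
Proof.
have vN1 : vF (- 1 : F) = 0%E.
  have := vFM (-1 : F) (-1); rewrite mulrNN mulr1 vF1.
  by case: (vF (-1)) => //= n [e]; congr (_%:E); lia.
by rewrite -mulN1r vFM vN1 add0e.
Qed.

Lemma vF_sum_ge (k : int) (I : Type) (s : seq I) (f : I -> F) :
  (forall j, (k%:E <= vF (f j))%E) -> (k%:E <= vF (\sum_(j <- s) f j)%R)%E.
Proof.
move=> kf; elim/big_rec: _ => [|j x _ kx]; first by rewrite vF0 leey.
by apply: le_trans (vFD _ _); rewrite le_min kf.
Qed.

Definition val_ring : {pred F} := fun a => (0 <= vF a)%E.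

Lemma val_ring_subring : subring_closed val_ring.
Proof.
split=> [|a b va vb|a b va vb]; rewrite /in_mem /= /val_ring.
- by rewrite vF1.
- by apply: le_trans (vFD _ _); rewrite vFN le_min; apply/andP.
- by rewrite vFM adde_ge0.
Qed.
HB.instance Definition _ := GRing.isSubringClosed.Build F val_ring val_ring_subring.

End Valuation.

(** * The field of scalars, its integers and its maximal ideal *)

Section Scalars.
Variables (F : naLocalFieldType) (V : vectType F).
Local Notation A := 'End(V).
Local Notation S := (scalars V).
Local Notation sc a := (a *: (\1%VF : A)).
Hypothesis V0 : (\1%VF : A) != 0.

Lemma scE (a : F) v : sc a v = a *: v.
Proof. by rewrite scale_lfunE id_lfunE. Qed.
Lemma scM (a b : F) : (sc a \o sc b)%VF = sc (a * b).
Proof. by apply/lfunP => v; rewrite comp_lfunE !scE scalerA. Qed.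
Lemma sc_inj (a b : F) : sc a = sc b -> a = b.
Proof.
move/eqP; rewrite -subr_eq0 -scalerBl scaler_eq0 (negPf V0) orbF subr_eq0.
by move/eqP.
Qed.
Lemma lfunX_sc (a : F) i : lfunX (sc a) i = sc (a ^+ i).
Proof.
elim: i => [|i IHi]; rewrite /lfunX /= ?scale1r // -/(lfunX _ i).
by rewrite IHi scM exprS.
Qed.

Lemma lfunXS (x : A) i : lfunX x i.+1 = (x \o lfunX x i)%VF. Proof. by []. Qed.

Lemma is_field_scalars : is_field S.
Proof.
split.
- by split=> //; exists 1; rewrite scale1r.
- by move=> _ _ [a ->] [b ->]; exists (a - b); rewrite scalerBl.
- by move=> _ _ [a ->] [b ->]; exists (a * b); rewrite scM.
- by move=> _ _ [a ->] [b ->]; rewrite !scM mulrC.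
move=> _ [a ->] a1; exists (sc a^-1); first by exists a^-1.
rewrite scM divff ?scale1r //.
by apply: contra a1 => /eqP->; rewrite scale0r.
Qed.

Lemma integral_sc (a : F) : integral (sc a) <-> (0 <= vF a)%E.
Proof.
split=> [[m [c [vc rel]]]|va]; last first.
  exists 1%N, (fun=> - a); split=> [_|]; first by rewrite vFN.
  by rewrite big_ord_recl big_ord0 addr0 !lfunX_sc expr0 expr1 scale1r scaleNr subrr.
rewrite leNgt; apply/negP => va.
have a0 : a != 0 by apply: contraTneq va => ->; rewrite vF0.
have [k ak] := vF_fin a0.
have k_lt0 : k < 0 by move: va; rewrite ak lte_fin.
have {}rel : a ^+ m + \sum_(i < m) c i * a ^+ i = 0.
  apply: sc_inj; rewrite scale0r -{}[RHS]rel lfunX_sc scalerDl scaler_suml.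
  by congr (_ + _); apply: eq_bigr => i _; rewrite lfunX_sc scalerA.
have vV : (1%:E <= vF (a^-1)%R)%E by rewrite (vFV a0 ak) lee_fin; lia.
(* Dividing the integral equation by [a ^+ m] writes 1 as a sum of terms of positive valuation. *)
have rel1 : 1 = - \sum_(i < m) c i * a ^- (m - i)%N.
  apply/eqP; rewrite -subr_eq0 opprK -(mulfV (expf_neq0 m a0)); apply/eqP.
  transitivity ((a ^+ m + \sum_(i < m) c i * a ^+ i) * a ^- m); last by rewrite rel mul0r.
  rewrite mulrDl mulr_suml; congr (_ + _); apply: eq_bigr => i _.
  rewrite -mulrA; congr (_ * _).
  have -> : a ^+ m = a ^+ (m - i)%N * a ^+ i by rewrite -exprD subnK // ltnW.
  rewrite invfM.
  by rewrite mulrCA mulfV ?expf_neq0 // mulr1.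
suff : (1%:E <= vF (1%R : F))%E by rewrite vF1.
rewrite {1}rel1 vFN; apply: vF_sum_ge => i.
rewrite vFM -[X in (X <= _)%E]add0e leeD //.
have : (0 < m - i)%N by rewrite subn_gt0.
case: (m - i)%N => // n _; rewrite -exprVn exprS vFM -[X in (X <= _)%E]adde0 leeD //.
have : a^-1 ^+ n \in @val_ring F by apply: rpredX; exact: le_trans vV.
by [].
Qed.

Lemma integers_scP x : integers S x <-> exists2 a : F, x = sc a & (0 <= vF a)%E.
Proof.
split=> [[[a ->] /integral_sc]|[a -> /integral_sc]]; first by exists a.
by split=> //; exists a.
Qed.

Lemma max_ideal_scP x : max_ideal S x <-> exists2 a : F, x = sc a & (1%:E <= vF a)%E.
Proof.
split=> [[/integers_scP[a -> va] nu]|[a -> va]].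
  exists a => //; have [->|a0] := eqVneq a 0; first by rewrite vF0 leey.
  have [k ak] := vF_fin a0; move: va; rewrite ak !lee_fin => k0.
  rewrite -gtz0_ge1 lt_def k0 andbT; apply/eqP => k_0; apply: nu.
  exists (sc a^-1); last by rewrite scM divff // scale1r.
  by apply/integers_scP; exists a^-1; rewrite // (vFV a0 ak) k_0 oppr0.
split; first by apply/integers_scP; exists a => //; exact: le_trans va.
move=> [_ /integers_scP[b -> vb]]; rewrite scM => ab1.
have : vF (a * b) = 0%E.
  by rewrite (_ : a * b = 1) ?vF1 //; apply: sc_inj; rewrite scale1r.
rewrite vFM => e; have := leeD va vb; rewrite e.
by rewrite adde0 lee_fin.
Qed.

End Scalars.

Section Spans.
Variables (F : naLocalFieldType) (V : vectType F).
Local Notation A := 'End(V).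
Implicit Types (I : set A) (s : seq V).

Lemma lin_spanB I s v w : (forall x y, I x -> I y -> I (x - y)) ->
  lin_span I s v -> lin_span I s w -> lin_span I s (v - w).
Proof.
move=> IB [c [Ic ->]] [c' [Ic' ->]]; exists (fun j => c j - c' j).
split=> [j|]; first exact: IB.
by rewrite -sumrB; apply: eq_bigr => j _; rewrite add_lfunE opp_lfunE.
Qed.

Lemma lin_span_act I s a v : (forall x, I x -> I (a \o x)%VF) ->
  lin_span I s v -> lin_span I s (a v).
Proof.
move=> aI [c [Ic ->]]; exists (fun j => (a \o c j)%VF); split=> [j|]; first exact: aI.
by rewrite linear_sum; apply: eq_bigr => j _; rewrite comp_lfunE.
Qed.

Lemma lin_span_nth I s (j : 'I_(size s)) : I 0 -> I \1%VF -> lin_span I s s`_j.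
Proof.
move=> I0 I1; exists (fun l => if l == j :> nat then \1%VF else 0).
split=> [l|]; first by case: ifP.
rewrite (bigD1 j) //= eqxx id_lfunE big1 ?addr0 // => l.
by rewrite -val_eqE /= => /negPf->; rewrite zero_lfunE.
Qed.

End Spans.

(** * Lattice chains over F are periodic chains *)

Section ScalarChain.
Variables (F : naLocalFieldType) (V : vectType F) (L : int -> set V).
Local Notation A := 'End(V).
Local Notation S := (scalars V).
Local Notation sc a := (a *: (\1%VF : A)).
Hypothesis V0 : (\1%VF : A) != 0.
Hypothesis LC : lattice_chain S L.

Let SO (a : F) : (0 <= vF a)%E -> integers S (sc a).
Proof. by move=> va; apply/(integers_scP V0); exists a. Qed.

Lemma lattice_chainB i v w : L i v -> L i w -> L i (v - w).
Proof.
have [/(_ i)[s -> _] _ _] := LC; apply: lin_spanB.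
move=> _ _ /(integers_scP V0)[a -> va] /(integers_scP V0)[b -> vb].
by rewrite -scalerBl; apply: SO; exact: (rpredB (va : a \in @val_ring F) vb).
Qed.

Lemma lattice_chainZ i (a : F) v : (0 <= vF a)%E -> L i v -> L i (a *: v).
Proof.
have [/(_ i)[s -> _] _ _] := LC; move=> va; rewrite -scE; apply: lin_span_act.
move=> _ /(integers_scP V0)[b -> vb]; rewrite scM; apply: SO.
exact: (rpredM (va : a \in @val_ring F) vb).
Qed.

Lemma lattice_chain0 i : L i 0.
Proof.
have [/(_ i)[s -> _] _ _] := LC; exists (fun=> 0); split=> [_|].
  by rewrite -(scale0r (\1%VF : A)); apply: SO; rewrite vF0 leey.
by rewrite big1 // => j _; rewrite zero_lfunE.
Qed.

Lemma lattice_chainD i v w : L i v -> L i w -> L i (v + w).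
Proof.
move=> Lv /(lattice_chainB (lattice_chain0 i)); rewrite sub0r => Lw.
by rewrite -[w]opprK; exact: lattice_chainB.
Qed.

Lemma lattice_chain_sum i (T : Type) (s : seq T) (P : pred T) (f : T -> V) :
  (forall j, P j -> L i (f j)) -> L i (\sum_(j <- s | P j) f j).
Proof.
move=> Lf; elim/big_rec: _ => [|j v Pj Lv]; first exact: lattice_chain0.
by apply: lattice_chainD => //; exact: Lf.
Qed.

(** A uniformiser shifts by the [e] of the chain, since it generates the maximal ideal. Units
    preserve every lattice, and all other scalars are products of these and inverses. *)
Lemma scalar_shift : exists2 e, 0 < e &
  forall (a : F) (k : int), a != 0 -> vF a = k%:E -> shift L (sc a) (k * e).
Proof.
have [_ _ [e e0 Le]] := LC; exists e%:Z => //.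
have [u vu] := @vF_uniformizer F.
have u0 : u != 0 by apply/eqP => u0; move: vu; rewrite u0 vF0.
have sh_u : shift L (sc u) e%:Z.
  move=> i v; rewrite Le scE; split=> [Lv|].
    exists [:: u *: v]; last by rewrite big_seq1.
    move=> _ /[1!inE] /eqP->; exists (sc u); last by exists v; rewrite ?scE.
    by apply/(max_ideal_scP V0); exists u; rewrite ?vu.
  move=> [s sP es]; rewrite -[v](scalerK u0) es scaler_sumr big_seq.
  apply: lattice_chain_sum => z /sP[_ /(max_ideal_scP V0)[a -> va] [w Lw <-]].
  rewrite scE scalerA; apply: lattice_chainZ => //.
  rewrite vFM (vFV u0 vu); have := leeD (lexx ((-1)%:E)) va.
  by rewrite -EFinD addNr.
have sh_unit (a : F) : a != 0 -> vF a = 0%:E -> shift L (sc a) 0.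
  move=> a0 va i v; rewrite addr0 scE; split=> Lv.
    by apply: lattice_chainZ Lv; rewrite va.
  rewrite -[v](scalerK a0); apply: lattice_chainZ Lv.
  by rewrite (vFV a0 va) oppr0.
have sh_nat (n : nat) (a : F) : a != 0 -> vF a = n%:Z%:E -> shift L (sc a) (n%:Z * e%:Z).
  elim: n a => [|n IHn] a a0 va; first by rewrite mul0r; exact: sh_unit.
  have -> : sc a = (sc u \o sc (u^-1 * a))%VF by rewrite scM mulVKf.
  have -> : n.+1%:Z * e%:Z = e%:Z + n%:Z * e%:Z by lia.
  apply: shift_comp => //; apply: IHn; first by rewrite mulf_neq0 ?invr_eq0.
  by rewrite vFM (vFV u0 vu) va -EFinD; congr (_%:E); lia.
move=> a k a0 va; have [k0|k0] := leP 0 k.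
  by have := sh_nat `|k|%N a a0; rewrite gez0_abs //; exact.
have ek : k = - `|k|%N%:Z by lia.
rewrite [in X in shift _ _ X]ek mulNr.
apply: (@shiftV _ _ _ (sc a^-1)); last first.
  apply: sh_nat; first by rewrite invr_eq0.
  by rewrite (vFV a0 va); congr (_%:E); lia.
by move=> v; rewrite -comp_lfunE scM mulVf // scale1r id_lfunE.
Qed.

Lemma lattice_chain_periodic : periodic_chain S L.
Proof.
have [e e0 shL] := scalar_shift.
have [Llat Lsub _] := LC.
have sub i v : L (i + 1) v -> L i v by case: (Lsub i) => + _; exact.
have leL i j v : i <= j -> L j v -> L i v.
  move=> le_ij; apply: (int_ind_up (Q := fun j => L j v -> L i v) _ _ le_ij) => //.
  by move=> k IHk /sub.
have shS x : S x -> x != 0 -> exists k, shift L x k.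
  move=> [a ->] a1; have a0 : a != 0 by apply: contra a1 => /eqP->; rewrite scale0r.
  by have [k ak] := vF_fin a0; exists (k * e); exact: shL.
split=> //.
- exact: is_field_scalars.
- exact: lattice_chainB.
- move=> i; apply: contrapT => nov; case: (Lsub i) => _; apply => v Lv.
  by apply: contrapT => nLv; apply: nov; exists v.
- move=> w; have [s es spans] := Llat 0.
  have [c [Sc ->]] : lin_span S s w by rewrite spans.
  elim/big_rec: _ => [|j v _ [k Lv]]; first by exists 0; exact: lattice_chain0.
  suff [l Ll] : exists l, L l (c j s`_j).
    exists (- (`|k| + `|l|)).
    by apply: lattice_chainD; [apply: leL Ll; lia | apply: leL Lv; lia].
  have Lsj : L 0 s`_j.
    rewrite es; apply: lin_span_nth; last first.
      by rewrite -(scale1r \1%VF); apply: SO; rewrite vF1.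
    by rewrite -(scale0r (\1%VF : A)); apply: SO; rewrite vF0 leey.
  have [->|cj0] := eqVneq (c j) 0.
    by exists 0; rewrite zero_lfunE; exact: lattice_chain0.
  by have [k' sh] := shS _ (Sc j) cj0; exists (0 + k'); exact: (sh 0 _).1.
- have [u vu] := @vF_uniformizer F.
  have u0 : u != 0 by apply/eqP => u0; move: vu; rewrite u0 vF0.
  exists (sc u), (1 * e); split; [by exists u | | by rewrite mul1r | exact: shL].
  by rewrite scaler_eq0 negb_or u0.
- move=> i; have [s es _] := Llat i; exists (size s), (fun j => s`_j); split=> [j|w].
    rewrite es; apply: lin_span_nth; last first.
      by rewrite -(scale1r \1%VF); apply: SO; rewrite vF1.
    by rewrite -(scale0r (\1%VF : A)); apply: SO; rewrite vF0 leey.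
  rewrite es => -[c [Ic ->]]; exists (fun j => c j); split=> // j.
  split; first by case: (Ic j).
  move=> l v Lv; have /(integers_scP V0)[a -> va] := Ic j.
  by rewrite scE; exact: lattice_chainZ.
Qed.

End ScalarChain.

(** * Lattice chains over extensions of F *)

Lemma char_poly_val_ring (F : naLocalFieldType) N (M : 'M[F]_N) :
  (forall i j, (0 <= vF (M i j))%E) -> forall i, (0 <= vF (char_poly M)`_i)%E.
Proof.
move=> vM; have : char_poly M \is a polyOver (@val_ring F).
  rewrite /char_poly /determinant; apply: rpred_sum => s _.
  rewrite rpredMsign; apply: rpred_prod => i _; rewrite !mxE.
  apply: rpredB; first by rewrite rpredMn // polyOverX.
  by rewrite polyOverC; exact: vM.
by move=> /polyOverP.
Qed.

Section ExtensionChain.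
Variables (F : naLocalFieldType) (V : vectType F).
Variables (K : set 'End(V)) (L : int -> set V).
Local Notation A := 'End(V).
Local Notation S := (scalars V).
Hypothesis LC : lattice_chain S L.
Hypothesis H : periodic_chain K L.
Implicit Types (x y : A) (k : int).
Let Kf := pc_field H.
Let V0 := field1_neq0 Kf.

Lemma shift_lfunX x k m : shift L x k -> shift L (lfunX x m) (m%:Z * k).
Proof.
move=> sx; elim: m => [|m IHm]; first by rewrite mul0r; exact: shift1.
by rewrite lfunXS -addn1 PoszD mulrDl mul1r addrC; exact: shift_comp.
Qed.

(** If [x] had shift [k < 0], the leading power [m + 1] would drop a vector of exact level 0 below
    level [m k], while all lower terms of the integral equation stay in [L (m k)]. *)
Lemma integral_stab x : K x -> integral x -> stab K L x.
Proof.
move=> Kx [m [a [va rel]]].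
have [->|x0] := eqVneq x 0; first exact: stab0 H.
have [k sx] := pc_shift H Kx x0; apply/(shift_stab H Kx sx).
rewrite leNgt; apply/negP => k_lt0.
case: m => [|m] in rel *.
  by case/negP: V0; apply/eqP; move: rel; rewrite big_ord0 addr0.
have [v Lv nLv] := pc_strict H 0; apply: nLv.
rewrite (shift_lfunX m.+1 sx 1).
have /eqP -> : lfunX x m.+1 v == - \sum_(i < m.+1) a i *: lfunX x i v.
  rewrite -addr_eq0; apply/eqP; rewrite -[RHS](zero_lfunE _ v) -rel add_lfunE sum_lfunE.
  by congr (_ + _); apply: eq_bigr => i _; rewrite scale_lfunE.
apply: (chainN H); apply: (chain_sum H) => i; apply: (lattice_chainZ V0 LC) => //.
apply: (chain_le H _ ((shift_lfunX i sx 0 v).1 Lv)).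
by have := ltn_ord i; nia.
Qed.

(* Cayley-Hamilton for the matrix of [x] on generators of [L 0]. *)
Lemma stab_integral x : stab K L x -> integral x.
Proof.
move=> [Kx Lx]; have [/(_ 0)[s es spans] _ _] := LC.
have I0 : integers S 0.
  by apply/(integers_scP V0); exists 0; rewrite ?scale0r // vF0 leey.
have I1 : integers S \1%VF.
  by apply/(integers_scP V0); exists 1; rewrite ?scale1r // vF1.
have Ls (j : 'I_(size s)) : L 0 s`_j by rewrite es; exact: lin_span_nth.
(* An empty generating family would make [L 0] zero, against strictness; square matrices of positive
   size form a ring. *)
have [N eN] : exists N, size s = N.+1.
  case: s es {spans Ls} => [|w s] es; last by exists (size s).
  have [v Lv nLv] := pc_strict H 0; case: nLv.
  move: Lv; rewrite es => -[c [_ ->]]; rewrite big_ord0; exact: chain0 H _.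
have /choice[M MP] (j : 'I_N.+1) : exists c : 'I_N.+1 -> F,
    (forall l, (0 <= vF (c l))%E) /\ x s`_j = \sum_l c l *: s`_l.
  have : L 0 (x s`_j).
    by apply: Lx; rewrite es; apply: lin_span_nth (cast_ord (esym eN) j) I0 I1.
  rewrite es => -[c [Ic ->]]; rewrite eN.
  have /choice[a aP] l : exists a : F, c l = a *: \1%VF /\ (0 <= vF a)%E.
    by have /(integers_scP V0)[a -> va] := Ic l; exists a.
  exists (fun l => a l); split=> [l|]; first by case: (aP l).
  by apply: eq_bigr => l _; rewrite (aP l).1 scE.
pose B : 'M[F]_N.+1 := \matrix_(j, l) M j l.
have powE m (j : 'I_N.+1) : lfunX x m s`_j = \sum_l (B ^+ m) j l *: s`_l.
  elim: m => [|m IHm] in j *.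
    rewrite id_lfunE expr0 (bigD1 j) //= mxE eqxx scale1r big1 ?addr0 // => l.
    by rewrite mxE eq_sym => /negPf->; rewrite scale0r.
  rewrite lfunXS comp_lfunE IHm linear_sum exprSr /=.
  under eq_bigr => l _ do rewrite linearZ /= (MP l).2 scaler_sumr.
  rewrite exchange_big; apply: eq_bigr => l _; rewrite mxE scaler_suml.
  by apply: eq_bigr => l' _; rewrite scalerA mxE.
pose chi := char_poly B.
have vchi : forall i : nat, (0 <= vF chi`_i)%E.
  by apply: char_poly_val_ring => i j; rewrite mxE; case: (MP i).
have chiE : \sum_(i < N.+2) chi`_i *: B ^+ i = 0.
  rewrite -[RHS](Cayley_Hamilton B) -/chi -[chi in RHS]coefK poly_def size_char_poly.
  rewrite linear_sum; apply: eq_bigr => i _.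
  by rewrite linearZ rmorphXn /= horner_mx_X.
exists N.+1, (fun i => chi`_i); split=> //; apply/lfunP => w.
have mon : chi`_N.+1 = 1.
  by have /monicP := char_poly_monic B; rewrite /lead_coef size_char_poly.
have -> : lfunX x N.+1 + \sum_(i < N.+1) chi`_i *: lfunX x i =
          \sum_(i < N.+2) chi`_i *: lfunX x i.
  by rewrite [RHS]big_ord_recr /= mon scale1r addrC.
set f := \sum_(i < N.+2) _.
have fs (j : 'I_N.+1) : f s`_j = 0.
  rewrite sum_lfunE; under eq_bigr => i _ do rewrite scale_lfunE powE scaler_sumr.
  rewrite exchange_big big1 //= => l _.
  under eq_bigr => i _ do rewrite scalerA.
  rewrite -scaler_suml; have /matrixP/(_ j l) := chiE.
  rewrite summxE mxE; under eq_bigr => i _ do rewrite mxE.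
  by move=> ->; rewrite scale0r.
have : lin_span S s w by rewrite spans.
move=> [c [Sc ->]]; rewrite zero_lfunE linear_sum big1 // => j _.
have [a ->] := Sc j; rewrite /= scE linearZ /=.
by rewrite (fs (cast_ord eN j)) scaler0.
Qed.

Lemma integers_stab : integers K = stab K L.
Proof.
apply/seteqP; split=> x; first by case; exact: integral_stab.
by move=> Ox; split; [case: Ox | exact: stab_integral].
Qed.

(** Generators over the integers of F also generate over those of [K]. The period is the generator
    [d] of the group of shifts, because a nonzero element of the maximal ideal of [K] has positive
    shift, hence shift at least [d]. *)
Lemma periodic_lattice_chain : lattice_chain K L.
Proof.
have [Llat Lsub _] := LC.
have [d [d0 exd perd]] := period_exists H.
have subI : integers S `<=` integers K.
  by move=> x [Sx ix]; split=> //; exact: (pc_scal H).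
split=> // [i|].
  have [s es spans] := Llat i; exists s.
    apply/seteqP; split=> v.
      by rewrite es => -[c [Ic ->]]; exists c; split=> // j; exact: subI.
    move=> [c [Ic ->]]; apply: (chain_sum H) => j; apply: (stabE (K := K)).
      by rewrite -integers_stab.
    rewrite es; apply: lin_span_nth; apply/(integers_scP V0).
      by exists 0; rewrite ?scale0r // vF0 leey.
    by exists 1; rewrite ?scale1r // vF1.
  apply/seteqP; split=> // v _; have : lin_span S s v by rewrite spans.
  by move=> [c [Sc ->]]; exists c; split=> // j; exact: (pc_scal H).
exists `|d|%N; first by lia.
rewrite gtz0_abs // => i; apply/seteqP; split=> [v Lv|_ [s sP ->]].
  have [x [Kx x0 sx]] := exd 1; rewrite mul1r in sx.
  have [y [Ky y0 xK yK]] := fieldV Kf Kx x0.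
  exists [:: v]; last by rewrite big_seq1.
  move=> _ /[1!inE] /eqP->; exists x; last first.
    by exists (y v); rewrite ?yK //; apply/(sx _ _).2; rewrite yK.
  split; first by rewrite integers_stab; apply/(shift_stab H Kx sx); lia.
  rewrite integers_stab => -[z Oz xz].
  have sz : shift L z (- d) by apply: shiftV sx => w; rewrite -comp_lfunE xz id_lfunE.
  by have /(shift_stab H (stab_sub Oz) sz) := Oz; lia.
rewrite big_seq; elim/big_rec: _ => [|z v /sP[x [+ nu] [w Lw <-]] Lv].
  exact: chain0 H _.
rewrite integers_stab => Ox; apply: (chainD H) => //.
have [->|x0] := eqVneq x 0; first by rewrite zero_lfunE; exact: chain0 H _.
have Kx := stab_sub Ox; have [k sx] := pc_shift H Kx x0.
apply: (chain_le H _ ((sx _ _).1 Lw)).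
have k0 : 0 <= k by apply/(shift_stab H Kx sx).
have [q ek] := perd _ _ Kx x0 sx.
have kn0 : k != 0.
  apply/eqP => k_0; apply: nu; have [y [Ky y0 xK yK]] := fieldV Kf Kx x0.
  exists y; last by apply/lfunP => v'; rewrite comp_lfunE yK id_lfunE.
  by rewrite integers_stab; apply/(shift_stab H Ky (shiftV yK sx)); lia.
have q1 : 1 <= q by nia.
by nia.
Qed.

End ExtensionChain.

(** * Strata *)

Section MaxZ.
Implicit Types (S : set int) (k m b : int).

Lemma is_maxz_maxz S m : is_maxz S m -> maxz S = m%:E.
Proof.
move=> [Sm maxm]; rewrite /maxz; case: asboolP => [S0|_]; first by rewrite S0 in Sm.
have ex : exists m, is_maxz S m by exists m.
rewrite asboolT //; congr (_%:E).
have [Sx maxx] := xgetPex 0 ex.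
by apply/eqP; rewrite eq_le maxm // maxx.
Qed.

Lemma maxz_fin S m : maxz S = m%:E -> is_maxz S m.
Proof.
rewrite /maxz; case: asboolP => // _; case: asboolP => // ex [<-].
exact: xgetPex ex.
Qed.

(** A nonempty set of integers bounded above attains its maximum, which excludes the conventional
    value [+oo]. *)
Lemma maxz_le S b : (forall k, S k -> k <= b) -> (maxz S <= b%:E)%E.
Proof.
move=> ub; have [S0|/existsNP[k0]] := pselect (forall k, ~ S k).
  have {}S0 : S = set0 by apply/seteqP; split=> // k /S0.
  by rewrite /maxz asboolT // leNye.
move=> /contrapT Sk0.
have nQ : ~ (exists2 k, S k & b + 1 <= k) by move=> [k /ub]; lia.
have le_k0 : k0 <= b + 1 by have := ub _ Sk0; lia.
have Q0 : exists2 k, S k & k0 <= k by exists k0.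
have [m [[k Sk le_mk] nm]] :=
  int_jump (Q := fun m => exists2 k, S k & m <= k) le_k0 Q0 nQ.
have maxk : is_maxz S k.
  split=> // l Sl; rewrite leNgt; apply/negP => lt_kl; apply: nm.
  by exists l => //; lia.
by rewrite (is_maxz_maxz maxk) lee_fin ub.
Qed.

Lemma maxz_lt S b k : (maxz S < b%:E)%E -> S k -> k < b.
Proof.
rewrite /maxz => + Sk; case: asboolP => [S0|_]; first by rewrite S0 in Sk.
case: asboolP => // ex; rewrite lte_fin => lt_b.
by apply: le_lt_trans lt_b; case: (xgetPex 0 ex) => _; exact.
Qed.

End MaxZ.

(** * Adjoining one element to a field *)

Section Adjunction.
Variables (F : naLocalFieldType) (V : vectType F).
Local Notation A := 'End(V).
Implicit Types (K E : set A) (x y b : A).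

Lemma field_lfunX E b i : is_field E -> E b -> E (lfunX b i).
Proof.
move=> Ef Eb; elim: i => [|i IHi]; first exact: field1.
by rewrite lfunXS; exact: fieldM.
Qed.

Lemma adjoin_sub K E b : is_field E -> K `<=` E -> E b -> adjoin K b `<=` E.
Proof.
move=> Ef KE Eb _ [m [c [Kc ->]]].
elim/big_rec: _ => [|i x _ Ex]; first exact: field0.
by apply: fieldD => //; apply: fieldM => //; [exact: KE | exact: field_lfunX].
Qed.

Lemma sub_adjoin K b : K `<=` adjoin K b.
Proof.
move=> x Kx; exists 1%N, (fun=> x); split=> //.
by rewrite big_ord_recl big_ord0 addr0 comp_lfun1r.
Qed.

Lemma adjoin_gen K b : is_field K -> adjoin K b b.
Proof.
move=> Kf; exists 2%N, (fun i => if i is 0%N then 0 else \1%VF); split=> [[|i]|].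
- exact: field0.
- exact: field1.
rewrite !big_ord_recl big_ord0 comp_lfun0l add0r addr0 comp_lfun1l.
by rewrite /lfunX /= comp_lfun1r.
Qed.

Lemma adjoinD K b x y : is_field K -> adjoin K b x -> adjoin K b y -> adjoin K b (x + y).
Proof.
move=> Kf [m [c [Kc ->]]] [m' [c' [Kc' ->]]].
(* Expansions of different lengths are padded with zero coefficients to the common length
   [m + m']. *)
pose ext n (c : nat -> A) i := if (i < n)%N then c i else 0.
have Kext n d i : (forall i, K (d i)) -> K (ext n d i).
  by move=> Kd; rewrite /ext; case: ifP => // _; exact: field0.
have extE n p (d : nat -> A) : (n <= p)%N ->
    \sum_(i < n) (d i \o lfunX b i)%VF = \sum_(i < p) (ext n d i \o lfunX b i)%VF.
  move=> le_np; rewrite (big_ord_widen _ (fun i => (d i \o lfunX b i)%VF) le_np).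
  rewrite big_mkcond.
  by apply: eq_bigr => i _; rewrite /ext; case: ifP => // _; rewrite comp_lfun0l.
exists (m + m')%N, (fun i => ext m c i + ext m' c' i); split=> [i|].
  by apply: fieldD => //; exact: Kext.
rewrite (extE m (m + m')%N) ?leq_addr // (extE m' (m + m')%N) ?leq_addl // -big_split.
by apply: eq_bigr => i _; rewrite comp_lfunDl.
Qed.

Lemma adjoinMl K b a x : is_field K -> K a -> adjoin K b x -> adjoin K b (a \o x)%VF.
Proof.
move=> Kf Ka [m [c [Kc ->]]]; exists m, (fun i => (a \o c i)%VF); split=> [i|].
  exact: fieldM.
elim/big_rec2: _ => [|i y1 y2 _ IH]; first by rewrite comp_lfun0r.
by rewrite comp_lfunDr IH comp_lfunA.
Qed.

Lemma adjoinMgen K b x : is_field K -> EndK K b ->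
  adjoin K b x -> adjoin K b (b \o x)%VF.
Proof.
move=> Kf Cb [m [c [Kc ->]]].
exists m.+1, (fun i => if i is i'.+1 then c i' else 0); split=> [[|i]|] //.
  exact: field0.
rewrite big_ord_recl comp_lfun0l add0r.
elim/big_rec2: _ => [|i y1 y2 _ IH]; first by rewrite comp_lfun0r.
rewrite comp_lfunDr -IH; congr (_ + _).
by apply/lfunP => v; rewrite lfunXS !comp_lfunE Cb.
Qed.

(** Multiplication by [beta] is multiplication by the coefficient [gamma] plus multiplication by
    [b], and both preserve polynomials in [b] over [K]. Hence all powers of [beta] are such
    polynomials. *)
Lemma adjoin_sub_gen K b beta gamma : is_field K -> scalars V `<=` K -> K gamma ->
  EndK K b -> beta = gamma + b -> adjoin (scalars V) beta `<=` adjoin K b.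
Proof.
move=> Kf SK Kg Cb eb _ [m [c [Sc ->]]].
have powE i : adjoin K b (lfunX beta i).
  elim: i => [|i IHi]; first by apply: sub_adjoin; exact: field1.
  rewrite lfunXS eb comp_lfunDl; apply: adjoinD => //.
    by rewrite -eb; exact: adjoinMl.
  by rewrite -eb; exact: adjoinMgen.
elim/big_rec: _ => [|i x _ IH]; first by apply: sub_adjoin; exact: field0.
by apply: adjoinD => //; apply: adjoinMl => //; exact: SK.
Qed.

End Adjunction.

(** * Orders through their filtration, and restriction to a centraliser *)

Section Restriction.
Variables (F : naLocalFieldType) (V : vectType F).
Local Notation A := 'End(V).

Lemma hereditaryE (K AA : set A) : hereditary_order K AA <->
  exists2 L : int -> set V, lattice_chain K L & AA = filt K L 0.
Proof.
split=> -[M LM ->]; exists M => //; apply/seteqP; split=> x [Cx Lx]; split=> // i v Lv.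
- by rewrite addr0; exact: Lx.
- by have := Lx i v Lv; rewrite addr0.
- by have := Lx i v Lv; rewrite addr0.
by rewrite addr0; exact: Lx.
Qed.

Lemma EndK_scalars (x : A) : EndK (scalars V) x.
Proof. by move=> _ [a ->] v; rewrite !scE linearZ. Qed.

Lemma filt_scalarsI (K : set A) (L : int -> set V) k : scalars V `<=` K ->
  filt K L k = filt (scalars V) L k `&` EndK K.
Proof.
move=> SK; apply/seteqP; split=> x [].
  by move=> Cx Lx; split=> //; split=> //; exact: EndK_scalars.
by move=> [_ Lx] Cx.
Qed.

End Restriction.

Theorem proposition4p4 (F : naLocalFieldType) (V : vectType F)
    (AA : set 'End(V)) (n r : int) (beta : 'End(V))
    (beta_tame_pure : tame_pure_stratum (scalars V) AA n r beta)
    (r_eq : (r%:E = - k0 (scalars V) AA beta)%E)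
    (gamma : 'End(V))
    (gamma_in : adjoin (scalars V) beta gamma)
    (gamma_simple : simple_stratum (scalars V) AA n r gamma)
    (gamma_equiv : equivalent_strata (scalars V) AA r gamma beta) :
  simple_stratum (adjoin (scalars V) gamma)
    (centralised_order (scalars V) AA gamma) r (r - 1) (beta - gamma).
Proof.
have [[[hAA _ _ _] Ef normE _] _] := beta_tame_pure.
have [[_ Kf normK _] k0g] := gamma_simple.
set S := scalars V in Ef Kf normE normK *.
set E := adjoin S beta in Ef normE.
set K := adjoin S gamma in Kf normK *.
have [L LC eAA] := (hereditaryE S AA).1 hAA.
have V0 := field1_neq0 Kf.
have PS := lattice_chain_periodic V0 LC.
have SK : S `<=` K by exact: sub_adjoin.
have SE : S `<=` E by exact: sub_adjoin.
have KE : K `<=` E by exact: adjoin_sub.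
have Kg : K gamma by exact/adjoin_gen/(pc_field PS).
have Eb : E beta by exact/adjoin_gen/(pc_field PS).
have Ebg : E (beta - gamma) by apply: fieldB => //; exact: KE.
have PK : periodic_chain K L.
  apply: (periodic_chain_extend PS) => // x Kx x0.
  by apply: (normaliser_shift PS); rewrite -eAA; exact: normK.
have LK := periodic_lattice_chain LC PK.
have CE x : E x -> EndK K x.
  by move=> Ex c Kc v; rewrite (fieldCE Ef) //; exact: KE.
have eB : centralised_order S AA gamma = filt K L 0.
  by rewrite /centralised_order eAA (filt_scalarsI _ _ SK).
set B := centralised_order S AA gamma in eB *.
have radA k : radX S AA k = filt S L k by rewrite eAA (radX_filt PS).
have radB k : radX K B k = filt K L k by rewrite eB (radX_filt PK).
have jacA : jacobson AA = filt S L 1 by rewrite eAA (jacobson_filt PS).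
have jacB : jacobson B = filt K L 1 by rewrite eB (jacobson_filt PK).
have comm_filt k x y : filt S L k x -> AA y -> filt S L k ((x \o y)%VF - (y \o x)%VF).
  rewrite eAA => fx fy; apply: (filtB PS); [exact: filtM0 fx fy | exact: filt0M fy fx].
have d_in : filt S L (- r) (beta - gamma).
  rewrite -opprB -sub0r; apply: (filtB PS); first exact: filt0 PS _.
  by move: gamma_equiv; rewrite /equivalent_strata radA.
have eE : adjoin K (beta - gamma) = E.
  apply/seteqP; split; first exact: adjoin_sub.
  by apply: (adjoin_sub_gen (gamma := gamma)) => //; [exact: CE | rewrite addrC subrK].
(* Since [r] is finite, so is the critical exponent of [beta]; this rules out [F[beta] = F] and
   makes [- r] an attained maximum. *)
have max_beta : is_maxz [set k | ~ (NN S AA beta k `<=`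
    [set x + y | x in centralised_order S AA beta & y in jacobson AA])] (- r).
  apply: maxz_fin; move: r_eq; rewrite /k0; case: asboolP => // _.
  by move=> e; rewrite EFinN e oppeK.
(* If [F[gamma] = F], then [B] is all of [AA]. Otherwise simplicity places [- r] strictly above the
   critical exponent of [gamma]. *)
have small_gamma : NN S AA gamma (- r) `<=` [set x + y | x in B & y in jacobson AA].
  move: k0g; rewrite /k0 -/S; case: asboolP => [eK _|_ lt_r].
    move=> x [Ax _]; exists x; last first.
      by exists 0; rewrite ?addr0 // jacA; exact: filt0 PS _.
    by split=> //; rewrite eK; exact: EndK_scalars.
  apply: contrapT => nsub.
  rewrite lteNr -EFinN in lt_r.
  by have := @maxz_lt _ _ (- r) lt_r nsub; rewrite ltxx.
have d_notin : ~ filt K L (1 - r) (beta - gamma).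
  rewrite (filt_scalarsI _ _ SK) => -[d_in' _].
  case: max_beta => + maxr; apply=> x [Ax fx].
  have [|b Bb [p Pp ebp]] := small_gamma x.
    split=> //; rewrite radA; rewrite radA in fx.
    (* The commutators with [beta] and [gamma] differ by the one with [beta - gamma], which lies in
       the power [- r] by [d_in]. *)
    have -> : (gamma \o x)%VF - (x \o gamma)%VF = ((beta \o x)%VF - (x \o beta)%VF) -
      (((beta - gamma) \o x)%VF - (x \o (beta - gamma))%VF).
      rewrite comp_lfunDl comp_lfunDr comp_lfunNl comp_lfunNr.
      apply/eqP; rewrite eq_sym subr_eq opprB addrACA.
      by rewrite [(gamma \o x)%VF + _]addrC subrK addKr.
    by apply: (filtB PS) => //; exact: comm_filt.
  have sub1 : NN S AA beta (1 - r) `<=`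
      [set x + y | x in centralised_order S AA beta & y in jacobson AA].
    by apply: contrapT => nsub; have := maxr _ nsub; lia.
  (* As [b] commutes with [gamma], its commutator with [beta] is the one with [beta - gamma], which
     the assumption to be refuted places in the power [1 - r]. *)
  have [|b' Bb' [p' Pp' ebp']] := sub1 b.
    have [Ab Cb] := Bb; split=> //; rewrite radA.
    have -> : (beta \o b)%VF - (b \o beta)%VF =
        ((beta - gamma) \o b)%VF - (b \o (beta - gamma))%VF.
      rewrite comp_lfunDl comp_lfunDr comp_lfunNl comp_lfunNr.
      have -> : (b \o gamma = gamma \o b)%VF.
        by apply/lfunP => v; rewrite !comp_lfunE Cb.
      by rewrite opprB addrA subrK.
    exact: comm_filt.
  exists b' => //; exists (p' + p); last by rewrite addrA ebp'.
  by move: Pp' Pp; rewrite jacA; exact: (filtD PS).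
have nu_d : nu K B (beta - gamma) = (- r)%:E.
  apply: is_maxz_maxz; split=> [|k]; rewrite /= radB.
    by rewrite (filt_scalarsI _ _ SK); split=> //; exact: CE.
  move=> fk; rewrite leNgt; apply/negP => lt_k; apply: d_notin.
  by apply: (filt_le PK _ fk); lia.
split.
  split; last exact: nu_d.
  - split; [ | by lia | exact: CE | by rewrite nu_d].
    by apply/hereditaryE; exists L.
  - by rewrite eE.
  (* An element of [F[beta]] normalises [AA] and commutes with [F[gamma]], and so does its inverse;
     conjugation therefore preserves the intersection [B]. *)
  rewrite eE => x Ex x0; have [_ [y [_ xy yx eA]]] := normE x Ex x0.
  have Cx := CE x Ex.
  have Cy : EndK K y.
    move=> c Kc v; rewrite -[in RHS](id_lfunE (c (y v))) -yx comp_lfunE Cx //.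
    by rewrite -[x (y v)]comp_lfunE xy id_lfunE.
  split=> //; exists y; split=> //; apply/seteqP; split=> [_ [a [Aa Ca] <-]|a [Aa Ca]].
    split; first by rewrite -eA; exists a.
    by move=> c Kc v; rewrite !comp_lfunE Cy // Ca // Cx.
  have [a' Aa' ea] : [set ((x \o a) \o y)%VF | a in AA] a by rewrite eA.
  have ea' : a' = (y \o a \o x)%VF.
    by rewrite -ea !comp_lfunA yx comp_lfun1l -comp_lfunA yx comp_lfun1r.
  exists a' => //; split=> // c Kc v.
  by rewrite ea' !comp_lfunE Cx // Ca // Cy.
(* The trivial extension has exponent [-oo]. Otherwise it suffices that every [k > - r] fails to be
   a critical index. *)
rewrite /k0; case: asboolP => _; first exact: ltey.
rewrite lteNr -EFinN; apply: (@le_lt_trans _ _ (- r)%:E); last by rewrite lte_fin; lia.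
apply: maxz_le => k nsub; rewrite leNgt; apply/negP => lt_k; apply: nsub.
move=> x [Bx fx]; have [Ax Cx] := Bx.
have subk : NN S AA beta k `<=`
    [set x + y | x in centralised_order S AA beta & y in jacobson AA].
  by case: max_beta => _ maxr; apply: contrapT => nsub; have := maxr _ nsub; lia.
have [|b [Ab Cb] [p Pp ebp]] := subk x.
  split=> //; rewrite radA.
  have -> : (beta \o x)%VF - (x \o beta)%VF =
      ((beta - gamma) \o x)%VF - (x \o (beta - gamma))%VF.
    rewrite comp_lfunDl comp_lfunDr comp_lfunNl comp_lfunNr.
    have -> : (x \o gamma = gamma \o x)%VF.
      by apply/lfunP => v; rewrite !comp_lfunE Cx.
    by rewrite opprB addrA subrK.
  by move: fx; rewrite radB (filt_scalarsI _ _ SK) => -[].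
(* Commuting with [F[beta]] implies commuting with [F[gamma]], so [b] lies in [B]. Then [p = x - b]
   also commutes with [F[gamma]] and lies in the radical of [B]. *)
have Bb : B b by split=> // c /KE/Cb.
exists b; first by split=> //; rewrite eE.
exists p => //; rewrite jacB (filt_scalarsI _ _ SK); split; first by rewrite -jacA.
have -> : p = x - b by rewrite -ebp addrC addKr.
have CBx : filt K L 0 x by rewrite -eB.
have CBb : filt K L 0 b by rewrite -eB.
by case: (filtB PK CBx CBb).
Qed.
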